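(* For all $n\ge1$: (a) $\mathbf{Q}_{n+1,n}\cdot(-1)^n=\nabla e_n$; (b) $\mathbf{Q}_{n,n}\cdot(-1)^n=(-qt)^{1-n}\,\nabla\Delta_{e_1}h_n=\Delta_{e_{n-1}}e_n$, where $\cdot(-1)^n$ means applying the operator to the constant symmetric function $(-1)^n$.
   Context: Symmetric functions in $\mathbf{x}=x_1+x_2+\cdots$ over $\mathbb{Q}(q,t)$, with plethystic notation ($f[E]$: write $f$ in power sums and replace $p_k$ by $E$ with all variables raised to the $k$-th power). $M=(1-t)(1-q)$; $D_nf[\mathbf{x}]=f[\mathbf{x}+M/z]\sum_{i\ge0}(-z)^ie_i[\mathbf{x}]\big|_{z^n}$. $\widetilde H_\mu[\mathbf{x};q,t]$ are the modified Macdonald polynomials (unique basis with $\widetilde H_\mu[\mathbf{x}(1-q)]\in\mathrm{span}\{s_\lambda:\lambda\ge\mu\}$, $\widetilde H_\mu[\mathbf{x}(1-t)]\in\mathrm{span}\{s_\lambda:\lambda\ge\mu'\}$ in dominance order, $\langle\widetilde H_\mu,s_{(|\mu|)}\rangle=1$). For a partition $\mu$, $B_\mu(q,t)=\sum_{(i,j)\in\mu}t^iq^j$, summing over cells of the diagram of $\mu$ with row index $i\ge0$ and column index $j\ge0$; $T_\mu=t^{n(\mu)}q^{n(\mu')}$ with $n(\mu)=\sum_i(i-1)\mu_i$. $\nabla$ is the linear operator with $\nabla\widetilde H_\mu=T_\mu\widetilde H_\mu$, and for a symmetric function $f$, $\Delta_f$ is the linear operator with $\Delta_f\widetilde H_\mu=f[B_\mu(q,t)]\widetilde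 H_\mu$. The operators are $\mathbf{Q}_{n+1,n}=\nabla D_n\nabla^{-1}$ and $\mathbf{Q}_{n,n}=\frac{qt}{qt-1}\nabla\,\underline{h_n[\tfrac{1-qt}{qt}\mathbf{x}]}\,\nabla^{-1}$, where $\underline{g}$ denotes multiplication by $g$. *)

(* Defs.v *)
From HB Require Import structures.
From mathcomp Require Import all_boot all_order all_algebra perm.
From mathcomp Require Import finmap fraction.
From mathcomp.multinomials Require Import monalg mpoly.

Set Implicit Arguments.
Unset Strict Implicit.
Unset Printing Implicit Defensive.

Import GRing.Theory.
Local Open Scope ring_scope.

(* The field Q(q,t). *)
Definition Qqt : fieldType := {fraction (mpoly 2 rat)}.
Definition q : Qqt := tofrac (mpolyX rat U_(ord0)%MM).
Definition t : Qqt := tofrac (mpolyX rat U_(ord_max)%MM).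

Section SymmetricFunctions.
Variable K : fieldType.

(* For K of characteristic 0, symmetric functions over K are the polynomials in
   the power sums p_1, p_2, p_3, ...; the i-th variable stands for p_(i+1).
   The lemmas expand_* below identify an element with the family of its
   expansions in finitely many variables x_0, ..., x_(N-1). *)
Definition Lam : comAlgType K := {malg K[{cmonom nat}]}.

(* p k is the power sum p_k for k >= 1; the value at k = 0 is irrelevant. *)
Definition p (k : nat) : Lam := << ucm k.-1 >>.

(* f[E], where [E k] is the image of p_k, i.e. the expression E with all its
   variables raised to the k-th power; coefficients are mapped by [iota]. *)
Definition pleth (S : comNzRingType) (iota : K -> S) (E : nat -> S)
    (f : Lam) : S :=
  monalg.mmap iota
    (fun m : {cmonom nat} => \prod_(i <- finsupp m) E i.+1 ^+ m i) f.

(* Plethysm by an expression in x, with values again in Lam. *)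
Definition plethx (E : nat -> Lam) (f : Lam) : Lam :=
  pleth (fun c => c%:A) E f.

(* Newton: n h_n = \sum_(1 <= k <= n) p_k h_(n-k); [hs n] is h_0, ..., h_n. *)
Fixpoint hs (n : nat) : seq Lam :=
  if n is m.+1 then
    rcons (hs m)
      (n%:R^-1 *: \sum_(i < n) p i.+1 * (hs m)`_(m - i))
  else [:: 1].
Definition h (n : nat) : Lam := (hs n)`_n.

(* Newton: n e_n = \sum_(1 <= k <= n) (-1)^(k-1) p_k e_(n-k). *)
Fixpoint es (n : nat) : seq Lam :=
  if n is m.+1 then
    rcons (es m)
      (n%:R^-1 *: \sum_(i < n) (-1) ^+ i * p i.+1 * (es m)`_(m - i))
  else [:: 1].
Definition e (n : nat) : Lam := (es n)`_n.

(* Schur functions, by the Jacobi-Trudi determinant det(h_(la_i - i + j)). *)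
Definition s (la : seq nat) : Lam :=
  \det (\matrix_(i < size la, j < size la)
     if (i <= nth 0%N la i + j)%N then h (nth 0%N la i + j - i) else 0).

(* The Hall scalar product: <p_la, p_mu> = z_la if la = mu, and 0 otherwise. *)
Definition zcoef (m : {cmonom nat}) : nat :=
  (\prod_(i <- finsupp m) (i.+1 ^ m i * (m i)`!))%N.
Definition hall (f g : Lam) : K :=
  \sum_(m <- monalg.msupp f)
    monalg.mcoeff m f * monalg.mcoeff m g * (zcoef m)%:R.

(* The span of the b i for i satisfying P. *)
Definition in_span (I : choiceType) (b : I -> Lam) (P : I -> Prop) (f : Lam) :=
  exists c : {malg K[I]},
    (forall i, i \in monalg.msupp c -> P i) /\
    f = \sum_(i <- monalg.msupp c) monalg.mcoeff i c *: b i.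

Definition is_basis (I : choiceType) (b : I -> Lam) :=
  forall f, exists! c : {malg K[I]},
    f = \sum_(i <- monalg.msupp c) monalg.mcoeff i c *: b i.

End SymmetricFunctions.

Arguments p {K} k.
Arguments h {K} n.
Arguments e {K} n.
Arguments s {K} la.

(* Partitions: weakly decreasing sequences of positive integers. *)
Definition is_intpart (mu : seq nat) : bool :=
  sorted geq mu && (0%N \notin mu).
Record intpart := IntPart { parts :> seq nat; _ : is_intpart parts }.
HB.instance Definition _ := [isSub for parts].
HB.instance Definition _ := [Choice of intpart by <:].

Definition conj_part (mu : seq nat) : seq nat :=
  mkseq (fun j => count (fun r => j < r)%N mu) (head 0%N mu).

Definition dominates (la mu : seq nat) : Prop :=
  sumn la = sumn mu /\
  forall k, (sumn (take k mu) <= sumn (take k la))%N.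

(* n(mu), with rows indexed from 0. *)
Definition nstat (mu : seq nat) : nat :=
  (\sum_(i < size mu) i * nth 0 mu i)%N.

Section Macdonald.
Variables (K : fieldType) (q t : K).
Local Notation Lam := (Lam K).

Definition T (mu : seq nat) : K := t ^+ nstat mu * q ^+ nstat (conj_part mu).

(* q and t are arguments, as plethysm by B_mu raises them to powers. *)
Definition B (mu : seq nat) (q t : K) : K :=
  \sum_(i < size mu) \sum_(j < nth 0%N mu i) t ^+ i * q ^+ j.

(* The scalar f[B_mu(q,t)]. *)
Definition plethB (f : Lam) (mu : seq nat) : K :=
  pleth idfun (fun k => B mu (q ^+ k) (t ^+ k)) f.

(* The characterization of the modified Macdonald polynomials. *)
Record is_modified_macdonald (H : intpart -> Lam) : Prop := {
  macdonald_basis : is_basis H;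
  macdonald_q : forall mu : intpart,
    in_span (fun la : intpart => s la) (fun la => dominates la mu)
      (plethx (fun k => (1 - q ^+ k) *: p k) (H mu));
  macdonald_t : forall mu : intpart,
    in_span (fun la : intpart => s la) (fun la => dominates la (conj_part mu))
      (plethx (fun k => (1 - t ^+ k) *: p k) (H mu));
  macdonald_norm : forall mu : intpart, hall (H mu) (s [:: sumn mu]) = 1
}.

(* L is the operator with eigenvectors H mu and eigenvalues c mu. *)
Definition diagonal_on (H : intpart -> Lam) (c : intpart -> K)
    (L : {linear Lam -> Lam}) :=
  forall mu, L (H mu) = c mu *: H mu.

Definition M (q t : K) : K := (1 - t) * (1 - q).

(* f[x + M/z] as a polynomial in 'X = 1/z. *)
Definition pleth_xMz (f : Lam) : {poly Lam} :=
  pleth (fun c => (c%:A : Lam)%:P)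
    (fun k => (p k)%:P + ((M (q ^+ k) (t ^+ k))%:A : Lam)%:P * 'X^k) f.

(* D_n f: the coefficient of z^n collects (1/z)^j * (-z)^i e_i for i = n + j. *)
Definition D (n : int) (f : Lam) : Lam :=
  \sum_(j < size (pleth_xMz f))
    if (n + j%:Z)%R is Posz i then (pleth_xMz f)`_j * ((-1) ^+ i * e i) else 0.

(* The operators Q_(n+1,n) and Q_(n,n); [nablaV] is the inverse of [nabla]. *)
Definition Q_succ (nabla nablaV : Lam -> Lam) (n : nat) (f : Lam) : Lam :=
  nabla (D n (nablaV f)).

Definition Q_diag (nabla nablaV : Lam -> Lam) (n : nat) (f : Lam) : Lam :=
  (q * t / (q * t - 1)) *:
  nabla (plethx (fun k => ((1 - (q * t) ^+ k) / (q * t) ^+ k) *: p k) (h n)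
         * nablaV f).

End Macdonald.

Lemma pchar_Qqt : [pchar Qqt] =i pred0.
Proof.
apply/pcharf0P => n; rewrite -(rmorph_nat (@tofrac (mpoly 2 rat))) tofrac_eq0.
by rewrite -mpolyC_nat mpolyC_eq0 Num.Theory.pnatr_eq0.
Qed.

Section PlethMorph.
Variables (K : fieldType).
Variables (S : comNzRingType) (iota : {rmorphism K -> S}) (E : nat -> S).

Let mon (m : {cmonom nat}) := \prod_(i <- finsupp m) E i.+1 ^+ m i.

Let monw (d : {fset nat}) (m : {cmonom nat}) :
  (finsupp m `<=` d)%fset -> mon m = \prod_(i <- d) E i.+1 ^+ m i.
Proof.
move=> sub; apply: big_fset_incl => // i _; rewrite -cmE_neq0 negbK.
by move=> /eqP->; rewrite expr0.
Qed.

Let monM : monalg.mmorphism mon.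
Proof.
split=> [m1 m2|]; last by rewrite /mon mdom1 big_seq_fset0.
rewrite {1}/mon mdomD (monw (fsubsetUl _ (finsupp m2))).
rewrite (monw (fsubsetUr (finsupp m1) _)) -big_split /=.
by apply: eq_bigr => i _; rewrite cmM exprD.
Qed.
HB.instance Definition _ := monalg.isMultiplicative.Build _ S mon monM.

Lemma pleth_is_zmod_morphism : zmod_morphism (pleth iota E).
Proof. exact: (@monalg.mmap_is_additive _ _ _ iota mon). Qed.
Lemma pleth_is_monoid_morphism : monoid_morphism (pleth iota E).
Proof. by have [? ?] := @monalg.mmap_is_multiplicative _ _ _ iota mon. Qed.

Lemma plethZ c f : pleth iota E (c *: f) = iota c * pleth iota E f.
Proof. exact: (@monalg.mmapZ _ _ _ iota mon). Qed.

Lemma pleth_p k : (0 < k)%N -> pleth iota E (p k) = E k.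
Proof.
case: k => // k _; rewrite /pleth monalg.mmapU /= rmorph1 mul1r mdomU.
by rewrite big_seq_fset1 ucmE eqxx.
Qed.
End PlethMorph.
HB.instance Definition _ (K : fieldType) (S : comNzRingType)
    (iota : {rmorphism K -> S}) E :=
  GRing.isZmodMorphism.Build (Lam K) S (pleth iota E)
    (pleth_is_zmod_morphism iota E).
HB.instance Definition _ (K : fieldType) (S : comNzRingType)
    (iota : {rmorphism K -> S}) E :=
  GRing.isMonoidMorphism.Build (Lam K) S (pleth iota E)
    (pleth_is_monoid_morphism iota E).

Section Expansion.
Variable K : fieldType.
Local Notation Lam := (Lam K).
Implicit Types f : Lam.

(* The expansion of f in the variables x_0, ..., x_(N-1). *)
Definition expand (N : nat) (f : Lam) : mpoly N K :=
  pleth (@mpolyC N K) (fun k => \sum_(i < N) mpolyX K U_(i)%MM ^+ k) f.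
HB.instance Definition _ N := GRing.RMorphism.copy (expand N) (pleth _ _).
Lemma expandZ N c f : expand N (c *: f) = c *: expand N f.
Proof. by rewrite /expand plethZ mul_mpolyC. Qed.
HB.instance Definition _ N :=
  GRing.isScalable.Build K Lam (mpoly N K) *:%R (expand N) (expandZ N).

Lemma expand_p N k : (0 < k)%N ->
  expand N (p k) = \sum_(i < N) mpolyX K U_(i)%MM ^+ k.
Proof. exact: pleth_p. Qed.

Lemma nth_last_rcons (l : seq Lam) n a :
  size l = n -> (rcons l a)`_n = a.
Proof. by move=> sz; rewrite nth_rcons sz ltnn eqxx. Qed.

Lemma size_hs n : size (hs K n) = n.+1.
Proof. by elim: n => //= n; rewrite size_rcons => ->. Qed.

Lemma nth_hs m i : (i <= m)%N -> (hs K m)`_i = h i.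
Proof.
elim: m => [|m IH] in i *; first by rewrite leqn0 => /eqP->.
rewrite leq_eqVlt ltnS => /predU1P[->//|le].
by rewrite /= nth_rcons size_hs ltnS le IH.
Qed.

Lemma h0 : h 0 = 1 :> Lam. Proof. by []. Qed.
Lemma hS n :
  h n.+1 = (n.+1%:R^-1 : K) *: \sum_(i < n.+1) p i.+1 * h (n - i).
Proof.
transitivity (n.+1%:R^-1 *: \sum_(i < n.+1) p i.+1 * (hs K n)`_(n - i)).
  exact: (nth_last_rcons _ (size_hs n)).
apply: congr1; apply: eq_bigr => i _.
by rewrite (nth_hs (leq_subr _ _)).
Qed.

Lemma size_es n : size (es K n) = n.+1.
Proof. by elim: n => //= n; rewrite size_rcons => ->. Qed.

Lemma nth_es m i : (i <= m)%N -> (es K m)`_i = e i.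
Proof.
elim: m => [|m IH] in i *; first by rewrite leqn0 => /eqP->.
rewrite leq_eqVlt ltnS => /predU1P[->//|le].
by rewrite /= nth_rcons size_es ltnS le IH.
Qed.

Lemma e0 : e 0 = 1 :> Lam. Proof. by []. Qed.
Lemma eS n :
  e n.+1 = (n.+1%:R^-1 : K) *: \sum_(i < n.+1) (-1) ^+ i * p i.+1 * e (n - i).
Proof.
transitivity
  (n.+1%:R^-1 *: \sum_(i < n.+1) (-1) ^+ i * p i.+1 * (es K n)`_(n - i)).
  exact: (nth_last_rcons _ (size_es n)).
apply: congr1; apply: eq_bigr => i _.
by rewrite (nth_es (leq_subr _ _)).
Qed.

#[local] Opaque p h e.

(* Newton's identity for the elementary symmetric polynomials. *)
Lemma mesym_Newton (R : comNzRingType) N n :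
  mesym N R n.+1 *+ n.+1 =
    \sum_(i < n.+1) (-1) ^+ i * (\sum_(j < N) mpolyX R U_(j)%MM ^+ i.+1)
                    * mesym N R (n - i).
Proof.
elim: N n => [|N IH] n.
  rewrite mesym_geqnE // mul0rn big1 // => i _.
  by rewrite big_ord0 mulr0 mul0r.
pose x := mpolyX R U_(ord_max : 'I_N.+1)%MM.
pose ee k := mwiden (mesym N R k).
pose pp k := mwiden (\sum_(j < N) mpolyX R U_(j)%MM ^+ k).
have eeS k : mesym N.+1 R k.+1 = ee k.+1 + ee k * x by exact: mesymSS.
have ppE k : \sum_(j < N.+1) mpolyX R U_(j)%MM ^+ k = pp k + x ^+ k.
  rewrite big_ord_recr /pp raddf_sum /=; congr (_ + _).
  by apply: eq_bigr => i _; rewrite rmorphXn /= mwidenX mnmwiden1.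
have {}IH k : ee k.+1 *+ k.+1 =
    \sum_(i < k.+1) (-1) ^+ i * pp i.+1 * ee (k - i)%N.
  rewrite /ee -raddfMn IH raddf_sum; apply: eq_bigr => i _.
  by rewrite /= !mwidenM rmorph_sign.
have ee0 : ee 0 = 1 by rewrite /ee mesym0E rmorph1.
have tele k : \sum_(i < k.+1) (-1) ^+ i * x ^+ i.+1 * mesym N.+1 R (k - i) =
    ee k * x.
  elim: k => [|k IHk].
    by rewrite big_ord1 mesym0E expr0 expr1 mul1r mulr1 ee0 mul1r.
  rewrite big_ord_recl expr0 expr1 mul1r subn0 eeS.
  have -> : \sum_(i < k.+1) (-1) ^+ lift ord0 i * x ^+ (lift ord0 i).+1 *
      mesym N.+1 R (k.+1 - lift ord0 i) = - (x * (ee k * x)).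
    rewrite -IHk mulr_sumr -sumrN; apply: eq_bigr => i _.
    rewrite /= /bump /= add1n subSS exprS [x ^+ i.+2]exprS mulN1r !mulNr.
    by rewrite mulrCA !mulrA.
  by rewrite mulrDr [x * (_ * x)]mulrC addrK mulrC.
under eq_bigr => i _ do rewrite ppE mulrDr mulrDl.
rewrite big_split /= tele eeS.
have -> : \sum_(i < n.+1) (-1) ^+ i * pp i.+1 * mesym N.+1 R (n - i) =
    ee n.+1 *+ n.+1 + ee n *+ n * x.
  case: n => [|n]; first by rewrite IH !big_ord1 mulr0n mul0r addr0 mesym0E ee0.
  rewrite !IH [LHS]big_ord_recr [X in _ = X + _]big_ord_recr /=.
  rewrite subnn mesym0E ee0.
  rewrite [RHS]addrAC; congr (_ + _); rewrite mulr_suml -big_split /=.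
  apply: eq_bigr => i _.
  by rewrite (subSn (leq_ord i)) eeS mulrDr [_ * (_ * x)]mulrA.
by rewrite mulrnDl -addrA -mulrnAl -mulrDl -mulrSr.
Qed.

Hypothesis pcharK0 : [pchar K] =i pred0.
Let natr_neq0 n : n.+1%:R != 0 :> K.
Proof. by rewrite ((pcharf0P K).1 pcharK0). Qed.

Lemma expand_e N n : expand N (e n) = mesym N K n.
Proof.
elim/ltn_ind: n => -[|n] IH; first by rewrite e0 rmorph1 mesym0E.
apply: (scalerI (natr_neq0 n)).
rewrite eS linearZ /= scalerA divff ?natr_neq0 // scale1r scaler_nat.
rewrite mesym_Newton rmorph_sum; apply: eq_bigr => i _.
by rewrite !rmorphM /= rmorph_sign expand_p // IH // ltnS leq_subr.
Qed.

(* The complete homogeneous symmetric polynomial. *)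
Definition hsym (R : comNzRingType) N n : mpoly N R :=
  \sum_(m : 'X_{1..N < n.+1} | mdeg m == n) mpolyX R m.

Lemma mcoeff_hsym (R : comNzRingType) N n m :
  mcoeff m (hsym R N n) = (mdeg m == n)%:R.
Proof.
rewrite raddf_sum /=; under eq_bigr => i _ do rewrite mcoeffX.
have [mn|mn] := eqVneq (mdeg m) n; last first.
  rewrite big1 // => i /eqP im; case: eqP => // im'.
  by rewrite -im im' eqxx in mn.
have lt : (mdeg m < n.+1)%N by rewrite mn.
rewrite (bigD1 (BMultinom lt)) /= ?mn ?eqxx // big1 ?addr0 // => i /andP[_ ne].
by case: eqP => // im; rewrite -val_eqE /= im eqxx in ne.
Qed.

Lemma hsym_Newton (R : comNzRingType) N n :
  hsym R N n.+1 *+ n.+1 =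
    \sum_(i < n.+1) (\sum_(j < N) mpolyX R U_(j)%MM ^+ i.+1) * hsym R N (n - i).
Proof.
have cf j k l m : mcoeff m (mpolyX R U_(j)%MM ^+ k * hsym R N l) =
    ((k <= m j)%N && (mdeg m == l + k)%N)%:R.
  rewrite mpolyXn mulrC; case: leqP => /= [le|gt].
    have le' : (U_(j) *+ k <= m)%MM.
      apply/mnm_lepP => i; rewrite mulmnE mnm1E; case: eqP => [<-|_].
        by rewrite mul1n.
      by rewrite mul0n.
    rewrite -{1}(submK le') addmC mcoeffMX mcoeff_hsym.
    by rewrite -{2}(submK le') mdegD mdegMn mdeg1 mul1n eqn_add2r.
  rewrite /hsym mulr_suml raddf_sum big1 //= => i _.
  rewrite -mpolyXD mcoeffX; case: eqP => // im.
  by move: gt; rewrite -im mnmDE mulmnE mnm1E eqxx mul1n ltnNge leq_addl.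
apply/mpolyP => m; rewrite mcoeffMn mcoeff_hsym raddf_sum /=.
have step (i : 'I_n.+1) : mcoeff m
    ((\sum_(j < N) mpolyX R U_(j)%MM ^+ i.+1) * hsym R N (n - i)) =
    \sum_(j < N) ((i < m j)%N && (mdeg m == n.+1))%:R.
  rewrite mulr_suml raddf_sum /=; apply: eq_bigr => j _.
  by rewrite cf addnS (subnK (leq_ord i)).
rewrite (eq_bigr _ (fun i _ => step i)) exchange_big /=.
have [mn|mn] := eqVneq (mdeg m) n.+1; last first.
  by rewrite mul0rn big1 // => j _; rewrite big1 // => i _; rewrite andbF.
rewrite -[_ *+ n.+1]/(n.+1%:R) -{1}mn mdegE natr_sum.
apply: eq_bigr => j _; under eq_bigr => i _ do rewrite andbT.
rewrite -natr_sum; congr (_%:R).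
have le : (m j <= n.+1)%N by rewrite -mn mdegE (bigD1 j) //= leq_addr.
rewrite -[LHS]card_ord -sum1_card (big_ord_widen n.+1 (fun=> 1%N) le).
rewrite big_mkcond.
by apply: eq_bigr => i _; case: ltnP.
Qed.

Lemma expand_h N n : expand N (h n) = hsym K N n.
Proof.
elim/ltn_ind: n => -[|n] IH.
  rewrite h0 rmorph1; apply/mpolyP => m.
  by rewrite mcoeff_hsym mcoeff1 mdeg_eq0.
apply: (scalerI (natr_neq0 n)).
rewrite hS linearZ /= scalerA divff ?natr_neq0 // scale1r scaler_nat.
rewrite hsym_Newton rmorph_sum; apply: eq_bigr => i _.
by rewrite !rmorphM /= expand_p // IH // ltnS leq_subr.
Qed.

Lemma expand_sym N f : expand N f \is symmetric.
Proof.
rewrite /expand /pleth /monalg.mmap; apply: rpred_sum => m _.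
rewrite mul_mpolyC; apply: rpredZ; apply: rpred_prod => i _; apply: rpredX.
apply/issymP => sg; rewrite raddf_sum [RHS](reindex_inj (@perm_inj _ sg)) /=.
apply: eq_bigr => j _.
by rewrite rmorphXn /= /msym mpoly.mmapX mmap1U.
Qed.

Section Generation.
Variable N : nat.
Let ev (g : mpoly N K) : Lam :=
  mpoly.mmap (in_alg Lam) (fun i : 'I_N => e i.+1) g.
HB.instance Definition _ := GRing.RMorphism.copy ev
  (mpoly.mmap (in_alg Lam) (fun i : 'I_N => e i.+1)).

Let evZ c g : ev (c *: g) = c *: ev g.
Proof. by rewrite /ev mpoly.mmapZ /= mulr_algl. Qed.

Let expand_ev g : expand N (ev g) = g \mPo [tuple mesym N K i.+1 | i < N].
Proof.
rewrite /ev /mpoly.mmap /comp_mpoly /mpoly.mmap raddf_sum.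
apply: eq_bigr => m _ /=; rewrite mulr_algl expandZ mul_mpolyC.
congr (_ *: _); rewrite /mmap1 rmorph_prod; apply: eq_bigr => i _.
by rewrite rmorphXn /= expand_e tnth_mktuple.
Qed.

Let ev_e k : (k <= N)%N -> exists g, e k = ev g.
Proof.
case: k => [_|k lt]; first by exists 1; rewrite rmorph1.
by exists (mpolyX K U_(Ordinal lt)%MM); rewrite /ev mpoly.mmapX mmap1U.
Qed.

Let im f := exists g, f = ev g.

Let imD f1 f2 : im f1 -> im f2 -> im (f1 + f2).
Proof. by move=> [g1 ->] [g2 ->]; exists (g1 + g2); rewrite rmorphD. Qed.
Let imM f1 f2 : im f1 -> im f2 -> im (f1 * f2).
Proof. by move=> [g1 ->] [g2 ->]; exists (g1 * g2); rewrite rmorphM. Qed.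
Let imZ c f : im f -> im (c *: f).
Proof. by move=> [g ->]; exists (c *: g); rewrite evZ. Qed.
Let im_sum (I : Type) r (P : pred I) F :
  (forall i, P i -> im (F i)) -> im (\sum_(i <- r | P i) F i).
Proof. by move=> HF; apply: big_ind => //; exists 0; rewrite rmorph0. Qed.
Let im_p k : (k < N)%N -> im (p k.+1).
Proof.
elim/ltn_ind: k => k IH lt.
pose S : Lam := \sum_(i < k) (-1) ^+ i * p i.+1 * e (k - i).
have SE : S = \sum_(i < k) (-1) ^+ i *: (p i.+1 * e (k - i)).
  apply: eq_bigr => i _; rewrite -mulrA -signr_odd mulr_sign.
  by rewrite -[X in X *: _]signr_odd scaler_sign.
have pE : (-1) ^+ k * p k.+1 = - S + k.+1%:R *: e k.+1.
  rewrite eS scalerA (divff (natr_neq0 k)) scale1r big_ord_recr /= subnn e0.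
  by rewrite [X in _ + (_ + X)]mulr1 addKr.
have {pE} -> : p k.+1 = (-1) ^+ k *: (k.+1%:R *: e k.+1 - S).
  rewrite [X in _ *: X]addrC -pE -signr_odd scaler_sign -signr_odd mulr_sign.
  by case: (odd k); rewrite ?opprK.
apply: imZ; apply: imD; first exact/imZ/ev_e.
rewrite SE -scaleN1r; apply: imZ; apply: im_sum => i _; apply: imZ; apply: imM.
  by apply: IH => //; apply: ltn_trans lt.
by apply: ev_e; rewrite (leq_trans (leq_subr _ _)) // ltnW.
Qed.

Let im_mon (m : {cmonom nat}) :
  (forall i, i \in finsupp m -> (i < N)%N) -> im (<< m >> : Lam).
Proof.
move=> bnd.
suff [mm [mmE]] : exists mm : {cmonom nat},
    (forall j, mm j = if j \in (finsupp m : seq nat) then m j else 0%N) /\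
    im (<< mm >> : Lam).
  suff -> : mm = m by [].
  by apply/eqP/cmP => j; rewrite mmE; case: finsuppP.
have: {subset (finsupp m : seq nat) <= finsupp m} by [].
have := fset_uniq (finsupp m).
elim: (finsupp m : seq nat) => [|i l IH] /=.
  move=> _ _; exists (onecm nat); split=> [j|]; first by rewrite onecmE.
  by exists 1; rewrite (rmorph1 ev).
move=> /andP[il ul] sub; have [|mm [mmE imm]] := IH ul.
  by move=> j jl; apply: sub; rewrite inE jl orbT.
have iN : (i < N)%N by apply/bnd/sub; rewrite inE eqxx.
have {sub}[m' [m'E im']] : exists m' : {cmonom nat},
   (forall j, m' j = (i == j) * m i)%N /\ im (<< m' >> : Lam).
  elim: (m i) => [|k [m' [m'E im']]].
    exists (onecm nat); split=> [j|]; first by rewrite onecmE muln0.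
    by exists 1; rewrite (rmorph1 ev).
  exists (mulcm (ucm i) m').
  split=> [j|]; first by rewrite mulcmE ucmE m'E mulnS.
  have -> : << mulcm (ucm i) m' >> = p i.+1 * << m' >> :> Lam.
    by rewrite malgM_def fgmulUU mulr1.
  exact: imM (im_p iN) im'.
exists (mulcm m' mm); split=> [j|].
  rewrite mulcmE m'E mmE inE eq_sym; case: eqVneq => [->|_]; last by [].
  by rewrite (negbTE il) mul1n addn0.
have -> : << mulcm m' mm >> = << m' >> * << mm >> :> Lam.
  by rewrite malgM_def fgmulUU mulr1.
exact: imM im' imm.
Qed.

Let im_f f :
  (forall m i, m \in monalg.msupp f -> i \in finsupp m -> (i < N)%N) -> im f.
Proof.
move=> bnd; rewrite (monalgE f) big_seq; apply: im_sum => m mf.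
have -> : << monalg.mcoeff m f *g m >> = monalg.mcoeff m f *: << m >> :> Lam.
  apply/malgP => k; rewrite [RHS]monalg.mcoeffZ [LHS]monalg.mcoeffU.
  by rewrite [in RHS]monalg.mcoeffU [RHS]mulr_natr.
by apply: imZ; apply: im_mon => i; apply: bnd.
Qed.

Let expand_inj_im f : im f -> expand N f = 0 -> f = 0.
Proof.
move=> [g ->]; rewrite expand_ev => /msym_fundamental_un0 ->.
by rewrite rmorph0.
Qed.

Lemma expand_inj_bnd f :
  (forall m i, m \in monalg.msupp f -> i \in finsupp m -> (i < N)%N) ->
  expand N f = 0 -> f = 0.
Proof. by move=> /im_f; apply: expand_inj_im. Qed.

Lemma expand_surj g : g \is symmetric -> exists f, expand N f = g.
Proof.
by move=> /sym_fundamental[g' [<- _]]; exists (ev g'); rewrite expand_ev.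
Qed.

End Generation.

Lemma expand_inj f : (forall N, expand N f = 0) -> f = 0.
Proof.
pose N := (\max_(m <- monalg.msupp f) \max_(i <- finsupp m) i.+1)%N.
move=> /(_ N); apply: expand_inj_bnd => m i mf im.
rewrite /N (big_rem m) //= leq_max; apply/orP; left.
by rewrite (big_rem i) //= leq_max leqnn.
Qed.

End Expansion.

(* Main.v *)
(* Let E(q,t) be the operator sending g to the constant term in z of g[x + (1-t)/z]
   Exp[-z(1-q)x]. It is conjugate, under x -> x(1-q), to D_0; for the parameters
   1/q and 1/t it is also conjugate, up to a rescaling of x, to the operator
   D_0' obtained from D_0 by inverting q and t and replacing x by -x. E(q,t) is
   triangular on the products h_la for the dominance order, with eigenvalue 1 -
   (1-q)(1-t) B_la(q,t): partial fractions in z turn E(q,t) h_la into sums of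
   products h_mu where mu arises from la by moving boxes to earlier parts.
   Combining the triangularity after x -> x(1-q) with the one after x -> x(1-t),
   which uses conjugate partitions and hence the opposite order, shows that
   every H_mu is an eigenvector of D_0 and of D_0', with eigenvalues 1 - M
   B_mu(q,t) and 1 - M(1/q,1/t) B_mu(1/q,1/t). So Delta_(e_1) = (1 - D_0)/M, and
   Delta_(e_(n-1)) is nabla (1 - D_0') divided by M(1/q,1/t) in degree n,
   because e_(n-1)[B_mu] = T_mu B_mu(1/q,1/t) when |mu| = n. Both operators are
   explicit on h_n and e_n, where they give scalar multiples of h_n[(1-qt)x]. *)
Require Import Defs.
From HB Require Import structures.
From mathcomp Require Import all_boot all_order all_algebra perm.
From mathcomp Require Import finmap fraction.
From mathcomp.multinomials Require Import mpoly monalg.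
From mathcomp Require Import ring zify.

Set Implicit Arguments.
Unset Strict Implicit.
Unset Printing Implicit Defensive.

Import GRing.Theory.
Local Open Scope ring_scope.

(** * Newton relations *)

Section LamGeneration.
Variable K : fieldType.
Local Notation Lam := (Lam K).

(** A monomial of positive degree is a power sum times a monomial of smaller degree, so constants
    and power sums generate; identities of ring morphisms are tested on these. *)
Lemma Lam_ind (P : Lam -> Prop) :
    (forall c : K, P c%:A) -> (forall k, (0 < k)%N -> P (p k)) ->
    (forall f g, P f -> P g -> P (f + g)) ->
    (forall f g, P f -> P g -> P (f * g)) ->
  forall f, P f.
Proof.
move=> PC Pp PD PM f.
have mulU (m1 m2 : {cmonom nat}) :
    << mulcm m1 m2 >> = << m1 >> * << m2 >> :> Lam.
  by rewrite malgM_def fgmulUU mulr1.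
have PX (m : {cmonom nat}) : P (<< m >> : Lam).
  have [N] := ubnP (monalg.mdeg m); elim: N m => // N IH m le.
  have [m0|m0] := posnP (monalg.mdeg m).
    by rewrite (mdeg_eq0I m0) -[<< _ >>]scale1r; apply: PC.
  have [i im] : exists i, i \in finsupp m.
    apply/fset0Pn; apply: contraL m0 => /eqP e0.
    by rewrite monalg.mdegE e0 big_seq_fset0.
  have mE : m = mulcm (ucm i) (divcm m (ucm i)).
    apply/eqP/cmP => j; rewrite mulcmE divcmE ucmE subnKC //.
    by case: eqP => [<-|]; rewrite ?lt0n ?cmE_neq0.
  rewrite mE mulU; apply: PM; first exact: (Pp i.+1).
  apply: IH; move: le; rewrite {1}mE monalg.mdegM mdegU; lia.
rewrite (monalgE f); apply: big_ind => // [|m _].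
  by rewrite -(scale0r 1); apply: PC.
have -> : << monalg.mcoeff m f *g m >> = (monalg.mcoeff m f)%:A * << m >> :> Lam.
  rewrite mulr_algl; apply/malgP => k; rewrite [RHS]monalg.mcoeffZ.
  by rewrite [LHS]monalg.mcoeffU [in RHS]monalg.mcoeffU [RHS]mulr_natr.
exact: PM.
Qed.

Lemma Lam_rmorph_ext (S : pzRingType) (f g : {rmorphism Lam -> S}) :
    (forall c : K, f c%:A = g c%:A) ->
    (forall k, (0 < k)%N -> f (p k) = g (p k)) ->
  f =1 g.
Proof.
move=> fgC fgp; apply: Lam_ind => // u v fu fv.
  by rewrite !rmorphD fu fv.
by rewrite !rmorphM fu fv.
Qed.

End LamGeneration.

Section Newton.
Variable S : comNzRingType.
Implicit Types (P H : nat -> S) (c : S).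

(** The relation sum_n H_n z^n = exp(sum_k P_k z^k / k) in logarithmic-derivative form, free of
    denominators and hence meaningful in any commutative ring. *)
Definition newton P H :=
  H 0%N = 1 /\
  forall n, n.+1%:R * H n.+1 = \sum_(i < n.+1) P i.+1 * H (n - i)%N.

Lemma eq_newton P P' H : (forall k, (0 < k)%N -> P k = P' k) ->
  newton P H -> newton P' H.
Proof.
move=> eqP [H0 HS]; split=> // n; rewrite HS.
by apply: eq_bigr => i _; rewrite eqP.
Qed.

Lemma newton_ext P P' H H' : (forall k, (0 < k)%N -> P k = P' k) -> H =1 H' ->
  newton P H -> newton P' H'.
Proof.
move=> eqP eqH /(eq_newton eqP)[H0 HS]; split=> [|n]; first by rewrite -eqH.
by rewrite -eqH HS; apply: eq_bigr => i _; rewrite eqH.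
Qed.

Lemma newton_uniq P H H' : (forall n, GRing.lreg (n.+1%:R : S)) ->
  newton P H -> newton P H' -> H =1 H'.
Proof.
move=> reg [H0 HS] [H0' HS']; elim/ltn_ind => -[|n] IH; first by rewrite H0.
apply: (reg n); rewrite HS HS'; apply: eq_bigr => i _.
by rewrite IH // ltnS leq_subr.
Qed.

Lemma newton_scale c P H :
  newton P H -> newton (fun k => c ^+ k * P k) (fun n => c ^+ n * H n).
Proof.
move=> [H0 HS]; split=> [|n]; first by rewrite H0 mulr1.
rewrite mulrCA HS mulr_sumr; apply: eq_bigr => i _.
have -> : c ^+ n.+1 = c ^+ i.+1 * c ^+ (n - i).
  by rewrite -exprD; congr (c ^+ _); have := ltn_ord i; lia.
by ring.
Qed.

Lemma coefM_eq n (A A' B B' : {poly S}) :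
    (forall i, (i <= n)%N -> A`_i = A'`_i) ->
    (forall i, (i <= n)%N -> B`_i = B'`_i) ->
  forall i, (i <= n)%N -> (A * B)`_i = (A' * B')`_i.
Proof.
move=> eqA eqB i le; rewrite !coefM; apply: eq_bigr => j _.
by rewrite eqA ?eqB //; have := ltn_ord j; lia.
Qed.

(** Adding power sums multiplies generating series, by the Leibniz rule for logarithmic derivatives;
    this is the addition formula for h_n[A+B]. *)
Lemma newton_conv P P' H H' : newton P H -> newton P' H' ->
  newton (fun k => P k + P' k) (fun n => \sum_(i < n.+1) H i * H' (n - i)%N).
Proof.
move=> [H0 HS] [H0' HS']; split=> [|n].
  by rewrite big_ord1 H0 H0' mulr1.
(* Truncation at degree n+1 keeps all coefficients of products up to that degree; [sh] puts 0 at
   index 0, since Newton's relation starts with P 1. *)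
pose tr (F : nat -> S) := \poly_(i < n.+2) F i.
pose sh (F : nat -> S) k := if k is _.+1 then F k else 0.
have trE F i : (i <= n.+1)%N -> (tr F)`_i = F i by rewrite coef_poly ltnS => ->.
have convE F F' m : (m <= n.+1)%N ->
    (tr F * tr F')`_m = \sum_(i < m.+1) F i * F' (m - i)%N.
  by move=> le; rewrite coefM; apply: eq_bigr => i _; rewrite !trE //;
    have := ltn_ord i; lia.
have shE Q F m : (m <= n)%N ->
    (tr (sh Q) * tr F)`_m.+1 = \sum_(i < m.+1) Q i.+1 * F (m - i)%N.
  move=> le; rewrite convE // big_ord_recl mul0r add0r.
  by apply: eq_bigr => i _; rewrite subSS.
have der Q F : newton Q F -> forall i, (i <= n.+1)%N ->
    ('X * (tr F)^`())`_i = (tr (sh Q) * tr F)`_i.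
  move=> [F0 FS] [|i] le.
    by rewrite coefXM convE // big_ord1 mul0r.
  by rewrite coefXM /= coef_deriv trE // shE // -mulr_natl FS.
have derM : 'X * (tr H * tr H')^`() =
    'X * (tr H)^`() * tr H' + tr H * ('X * (tr H')^`()).
  by rewrite derivM mulrDr mulrA [X in _ + X]mulrCA.
have dH := der _ _ (conj H0 HS); have dH' := der _ _ (conj H0' HS').
transitivity (('X * (tr H * tr H')^`())`_n.+1).
  by rewrite coefXM /= coef_deriv convE // mulr_natl.
rewrite derM coefD (coefM_eq dH (fun _ _ => erefl)) //.
rewrite (coefM_eq (fun _ _ => erefl) dH') // [tr H * _]mulrCA -mulrA -coefD.
rewrite -mulrDl coefM big_ord_recl.
rewrite coefD /tr !coef_poly /= addr0 mul0r add0r.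
apply: eq_bigr => i _ /=; rewrite coefD !coef_poly subSS !ltnS /= /bump /=.
by rewrite add1n leq_ord convE // leqW ?leq_subr.
Qed.

Lemma newton_geom c : newton (fun k => c ^+ k) (fun n => c ^+ n).
Proof.
split=> // n; under eq_bigr => i _ do
  rewrite -exprD addSn subnKC ?(leq_ord i) //.
by rewrite sumr_const card_ord mulr_natl.
Qed.

(** The series here is 1 - c z, the inverse of the geometric series. *)
Lemma newton_neg_geom c : newton (fun k => - c ^+ k)
  (fun n => if n is n'.+1 then if n' is 0%N then - c else 0 else 1).
Proof.
split=> // -[|n]; first by rewrite big_ord1 mul1r mulr1 expr1.
rewrite mulr0 (big_ord_recr n.+1) /= subnn mulr1.
rewrite (big_ord_recr n) /= subSnn big1 => [|i _].
  by rewrite !exprS; ring.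
have -> : (n.+1 - i = (n - i.+1).+2)%N by have := ltn_ord i; lia.
by rewrite mulr0.
Qed.

End Newton.

Lemma newton_morph (S S' : comNzRingType) (f : {rmorphism S -> S'}) P H :
  newton P H -> newton (fun k => f (P k)) (fun n => f (H n)).
Proof.
move=> [H0 HS]; split=> [|n]; first by rewrite H0 rmorph1.
rewrite -[n.+1%:R](rmorph_nat f) -rmorphM HS rmorph_sum.
by apply: eq_bigr => i _; rewrite rmorphM.
Qed.

(** * Plethystic substitutions *)

Section Contraction.
Variable S : comNzRingType.
Implicit Types (G : nat -> S) (P Q : {poly S}).

(* The coefficient of z^(-m) in P(1/z) * G(z), where G(z) = sum_j G_j z^j. *)
Definition cont (G : nat -> S) m (P : {poly S}) : S :=
  \sum_(j < size P) P`_j * G (m + j)%N.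

Lemma contw G m P N : (size P <= N)%N ->
  cont G m P = \sum_(j < N) P`_j * G (m + j)%N.
Proof.
move=> le; rewrite /cont (big_ord_widen N (fun j => P`_j * G (m + j)%N)) //.
rewrite big_mkcond; apply: eq_bigr => j _; case: ltnP => // le'.
by rewrite nth_default ?mul0r.
Qed.

Lemma contD G m P Q : cont G m (P + Q) = cont G m P + cont G m Q.
Proof.
pose N := maxn (size P) (size Q).
rewrite !(@contw G m _ N) ?leq_maxl ?leq_maxr ?(leq_trans (size_polyD P Q)) //.
by rewrite -big_split; apply: eq_bigr => j _; rewrite coefD mulrDl.
Qed.

Lemma contZ G m a P : cont G m (a *: P) = a * cont G m P.
Proof.
rewrite (contw _ _ (size_scale_leq a P)) /cont mulr_sumr.
by apply: eq_bigr => j _; rewrite coefZ mulrA.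
Qed.

Lemma cont0 G m : cont G m 0 = 0.
Proof. by rewrite /cont size_poly0 big_ord0. Qed.

Lemma cont_sum G m (I : Type) (r : seq I) F :
  cont G m (\sum_(i <- r) F i) = \sum_(i <- r) cont G m (F i).
Proof.
by elim: r => [|i r IH]; rewrite ?big_nil ?cont0 // !big_cons contD IH.
Qed.

Lemma contX G m k P : cont G m (P * 'X^k) = cont G (m + k) P.
Proof.
rewrite (@contw G m _ (k + size P)); last first.
  by rewrite (leq_trans (size_polyMleq _ _)) // size_polyXn; lia.
rewrite big_split_ord /= big1 ?add0r => [|i _].
  by apply: eq_bigr => j _; rewrite coefMXn ltnNge leq_addr addKn addnA.
by rewrite coefMXn ltn_ord mul0r.
Qed.

Lemma contC G m a : cont G m a%:P = a * G m.
Proof.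
rewrite (@contw G m _ 1) ?size_polyC ?leq_b1 //.
by rewrite big_ord1 coefC addn0.
Qed.

Lemma eq_cont G G' m P : G =1 G' -> cont G m P = cont G' m P.
Proof. by move=> e; apply: eq_bigr => j _; rewrite e. Qed.

End Contraction.

Lemma rmorph_cont (S S' : comNzRingType) (f : {rmorphism S -> S'}) G m P :
  f (cont G m P) = cont (f \o G) m (map_poly f P).
Proof.
rewrite (contw _ _ (size_poly _ _)) /cont rmorph_sum.
by apply: eq_bigr => j _; rewrite rmorphM coef_map.
Qed.

Lemma lreg_natr_poly (S : nzRingType) n :
  GRing.lreg (n%:R : S) -> GRing.lreg (n%:R : {poly S}).
Proof.
move=> reg P Q /polyP eqPQ; apply/polyP => i; apply: reg.
by have := eqPQ i; rewrite !mulr_natl !coefMn.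
Qed.

Lemma scale_polyCX (K : fieldType) (A : comAlgType K) (a b : K) (x : A) k :
  a%:A *: (x%:P + b%:A%:P * 'X^k) = (a *: x)%:P + (a * b)%:A%:P * 'X^k.
Proof.
rewrite scalerDr -!mul_polyC mulrA -!polyCM mulr_algl.
by rewrite -scalerAl mul1r scalerA.
Qed.

Lemma polyCX_scale (K : fieldType) (A : comAlgType K) (c : K) (x : A) k :
  x%:P * ('X^k * c%:A%:P) = (c *: x) *: 'X^k.
Proof. by rewrite -mul_polyC -[c *: x]mulr_algr polyCM -mulrA [_ * 'X^k]mulrC. Qed.

(** * Rescaling of power sums and contraction operators *)

Section Substitutions.
Variable K : fieldType.
Local Notation Lam := (Lam K).
Implicit Types (u v w : nat -> K) (f g : Lam).

Definition scl u : Lam -> Lam := plethx (fun k => u k *: p k).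
HB.instance Definition _ u :=
  GRing.RMorphism.copy (scl u) (pleth (in_alg Lam) (fun k => u k *: p k)).
Lemma scl_scalable u : scalable (scl u).
Proof. by move=> c f; rewrite -[RHS]mulr_algl; exact: (plethZ (in_alg Lam)). Qed.
HB.instance Definition _ u :=
  GRing.isScalable.Build K Lam Lam *:%R (scl u) (scl_scalable u).

Lemma sclZ u c f : scl u (c *: f) = c *: scl u f.
Proof. exact: scl_scalable. Qed.

Lemma scl_p u k : (0 < k)%N -> scl u (p k) = u k *: p k.
Proof. exact: (pleth_p (in_alg Lam)). Qed.

Lemma sclA u c : scl u c%:A = c%:A.
Proof. by rewrite sclZ rmorph1. Qed.

#[local] Opaque p h e scl.

Lemma scl_comp u v w f : (forall k, (0 < k)%N -> u k * v k = w k) ->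
  scl u (scl v f) = scl w f.
Proof.
move=> uvw; apply: (@Lam_rmorph_ext _ _ (scl u \o scl v) (scl w)) => /= [c|k k0].
  by rewrite !sclA.
by rewrite (scl_p v k0) sclZ (scl_p u k0) (scl_p w k0) scalerA mulrC (uvw k k0).
Qed.

Lemma scl_id u f : (forall k, (0 < k)%N -> u k = 1) -> scl u f = f.
Proof.
move=> u1; apply: (@Lam_rmorph_ext _ _ (scl u) idfun) => /= [c|k k0].
  by rewrite sclA.
by rewrite (scl_p u k0) (u1 k k0) scale1r.
Qed.

(** f[x + V/z] as a polynomial in 1/z, where [v k] is the k-th power sum of V. Both V = M (for D_0)
    and V = 1-t (for E(q,t)) occur. *)
Definition psi v : Lam -> {poly Lam} :=
  pleth (fun c => (c%:A : Lam)%:P)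
    (fun k => (p k)%:P + ((v k)%:A : Lam)%:P * 'X^k).
HB.instance Definition _ v :=
  GRing.RMorphism.copy (psi v) (pleth (polyC \o in_alg Lam)
    (fun k => (p k)%:P + ((v k)%:A : Lam)%:P * 'X^k)).

Lemma psi_p v k : (0 < k)%N -> psi v (p k) = (p k)%:P + (v k)%:A%:P * 'X^k.
Proof. exact: (@pleth_p _ _ (polyC \o in_alg Lam)). Qed.

Lemma psiZ v c f : psi v (c *: f) = c%:A *: psi v f.
Proof.
by rewrite -mul_polyC; apply: (@plethZ _ _ (polyC \o in_alg Lam)).
Qed.

Lemma psiA v c : psi v c%:A = c%:A%:P.
Proof. by rewrite psiZ rmorph1 -mul_polyC mulr1. Qed.

Lemma eq_psi v w f : (forall k, (0 < k)%N -> v k = w k) -> psi v f = psi w f.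
Proof.
move=> vw; apply: (@Lam_rmorph_ext _ _ (psi v) (psi w)) => /= [c|k k0].
  by rewrite !psiA.
by rewrite (psi_p v k0) (psi_p w k0) (vw k k0).
Qed.

#[local] Opaque psi.

(** The coefficient of z^(-m) in f[x + V/z] G(z). General m is kept because expanding a factor of f
    shifts it. *)
Definition opD v G m f := cont G m (psi v f).

Lemma opD_is_zmod_morphism v G m : zmod_morphism (opD v G m).
Proof.
move=> f g; rewrite /opD rmorphB /= contD -scaleN1r contZ.
by rewrite mulN1r.
Qed.
HB.instance Definition _ v G m := GRing.isZmodMorphism.Build Lam Lam
  (opD v G m) (opD_is_zmod_morphism v G m).
Lemma opD_scalable v G m : scalable (opD v G m).
Proof. by move=> c f; rewrite /opD psiZ contZ mulr_algl. Qed.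
HB.instance Definition _ v G m :=
  GRing.isScalable.Build K Lam Lam *:%R (opD v G m) (opD_scalable v G m).

Lemma opD1 v G m : opD v G m 1 = G m.
Proof. by rewrite /opD rmorph1 contC mul1r. Qed.

Lemma eq_opD v v' G G' m f : (forall k, (0 < k)%N -> v k = v' k) -> G =1 G' ->
  opD v G m f = opD v' G' m f.
Proof. by move=> /eq_psi eqv /eq_cont eqG; rewrite /opD eqv eqG. Qed.

(** On power sums, shifting by V/z and then rescaling the coefficients by u gives u_k p_k + v_k
    z^(-k); so does rescaling first and then shifting by V'/z. *)
Lemma scl_opD u v v' G f : (forall k, (0 < k)%N -> v k = u k * v' k) ->
  scl u (opD v G 0 f) = opD v' (scl u \o G) 0 (scl u f).
Proof.
move=> vE; rewrite /opD.
have -> : psi v' (scl u f) = map_poly (scl u) (psi v f).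
  apply: (@Lam_rmorph_ext _ _ (psi v' \o scl u) (map_poly (scl u) \o psi v)).
    by move=> c /=; rewrite sclA !psiA map_polyC /= sclA.
  move=> k k0 /=; rewrite (scl_p u k0) psiZ (psi_p v k0) (psi_p v' k0).
  rewrite rmorphD rmorphM /= map_polyXn !map_polyC /= sclA (scl_p u k0).
  by rewrite (vE k k0) scale_polyCX.
exact: rmorph_cont.
Qed.

End Substitutions.

(** * Plethysms of complete functions in characteristic zero *)

Section CharZero.
Variable K : fieldType.
Hypothesis pcharK0 : [pchar K] =i pred0.
Local Notation Lam := (Lam K).
Implicit Types (u v w : nat -> K) (f g : Lam).

#[local] Opaque p h e scl psi.

Let natr_neq0 n : n.+1%:R != 0 :> K.
Proof. by rewrite ((pcharf0P K).1 pcharK0). Qed.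

Lemma natr_lreg n : GRing.lreg (n.+1%:R : K).
Proof. exact/lregP. Qed.

Lemma natr_lreg_Lam n : GRing.lreg (n.+1%:R : Lam).
Proof.
by move=> f g; rewrite !mulr_natl -!scaler_nat => /(scalerI (natr_neq0 n)).
Qed.

Lemma newton_h : newton (@p K) h.
Proof.
split=> [|n]; first exact: h0.
by rewrite hS mulr_natl -scaler_nat scalerA (divff (natr_neq0 n)) scale1r.
Qed.

Lemma newton_e : newton (fun k => - p k : Lam) (fun n => (-1) ^+ n * e n).
Proof.
split=> [|n]; first by rewrite e0 mulr1.
rewrite eS mulrCA mulr_natl -scaler_nat scalerA (divff (natr_neq0 n)).
rewrite scale1r mulr_sumr; apply: eq_bigr => i _.
have -> : (-1) ^+ n.+1 = - ((-1) ^+ i * (-1) ^+ (n - i)) :> Lam.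
  by rewrite -exprD subnKC ?leq_ord // exprS mulN1r.
have : (-1) ^+ i * (-1) ^+ i = 1 :> Lam by rewrite -expr2 sqrr_sign.
move: ((-1) ^+ i) ((-1) ^+ (n - i)) (p i.+1) (e (n - i)) => a b c d aa.
by rewrite -[RHS]mul1r -aa; ring.
Qed.

(** Newton's relation has a unique solution, so a plethysm of h_n is computed by exhibiting a
    sequence that satisfies the transported relation. *)
Lemma rmorph_h (S : comNzRingType) (f : {rmorphism Lam -> S}) P H :
    (forall n, GRing.lreg (n.+1%:R : S)) ->
    (forall k, (0 < k)%N -> f (p k) = P k) -> newton P H ->
  forall n, f (h n) = H n.
Proof.
move=> reg fp; apply: newton_uniq => //.
exact: (eq_newton fp (newton_morph f newton_h)).
Qed.

Lemma scl_h u H : newton (fun k => u k *: p k : Lam) H ->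
  forall n, scl u (h n) = H n.
Proof. by apply: rmorph_h => [|k k0]; [exact: natr_lreg_Lam|exact: scl_p]. Qed.

Lemma newton_scl u : newton (fun k => u k *: p k : Lam) (fun n => scl u (h n)).
Proof.
by apply: eq_newton (newton_morph (scl u) newton_h) => k k0; rewrite /= scl_p.
Qed.

Lemma sclN1_h n : scl (fun=> -1) (h n) = (-1) ^+ n * e n :> Lam.
Proof.
apply: (scl_h (H := fun n => (-1) ^+ n * e n)); apply: eq_newton newton_e => k _.
by rewrite scaleN1r.
Qed.

Lemma scl_geom_h (c : K) n : scl (fun k => c ^+ k) (h n) = c ^+ n *: h n.
Proof.
have cX k f : (c%:A : Lam) ^+ k * f = c ^+ k *: f by rewrite exprZn expr1n mulr_algl.
rewrite -cX; apply: (scl_h (H := fun n => (c%:A : Lam) ^+ n * h n)).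
by apply: eq_newton (newton_scale (c%:A : Lam) newton_h) => k _; rewrite cX.
Qed.

Lemma scl_conv u v w n : (forall k, (0 < k)%N -> u k + v k = w k) ->
  \sum_(i < n.+1) scl u (h i) * scl v (h (n - i)) = scl w (h n).
Proof.
move=> uvw; symmetry.
apply: (scl_h (H := fun n => \sum_(i < n.+1) scl u (h i) * scl v (h (n - i)))).
apply: eq_newton (newton_conv (newton_scl u) (newton_scl v)) => k k0.
by rewrite -scalerDl (uvw k k0).
Qed.

Lemma psi_h v c n : newton v c ->
  psi v (h n) = \sum_(j < n.+1) (c j *: h (n - j)%N) *: 'X^j.
Proof.
move=> nv; have nx : newton (fun k => (v k)%:A%:P * 'X^k)
    (fun n => 'X^n * (c n)%:A%:P : {poly Lam}).
  apply: eq_newton (newton_scale 'X (newton_morph (polyC \o in_alg Lam) nv)).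
  by move=> k _; rewrite mulrC.
rewrite (rmorph_h (f := psi v) (fun n => lreg_natr_poly (@natr_lreg_Lam n)) (@psi_p _ v)
  (newton_conv (newton_morph polyC newton_h) nx)).
rewrite (reindex_inj rev_ord_inj) /=; apply: eq_bigr => j _.
by rewrite subSS (subKn (leq_ord j)) polyCX_scale.
Qed.

Lemma opD_h v c G m a f : newton v c ->
  opD v G m (h a * f) =
  \sum_(j < a.+1) c j *: (h (a - j)%N * opD v G (m + j) f).
Proof.
move=> nv; rewrite /opD rmorphM /= (psi_h _ nv) mulr_suml cont_sum.
apply: eq_bigr => j _; rewrite -scalerAl contZ [_ * psi _ _]mulrC contX.
by rewrite -scalerAl.
Qed.

End CharZero.

(** * Triangularity on complete products *)

Section Span.
Variables (K : fieldType) (V : lmodType K) (I : Type) (b : I -> V).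
Implicit Types (P Q : I -> Prop).

(** An inductive span makes closure properties provable by induction; [spn_malg] converts it to
    finitely supported coefficients. *)
Inductive spn P : V -> Prop :=
| spn0 : spn P 0
| spn_cons c i v : P i -> spn P v -> spn P (c *: b i + v).

Lemma spn_b P i : P i -> spn P (b i).
Proof. by move=> Pi; rewrite -[b i]scale1r -[_ *: _]addr0; apply: spn_cons (spn0 P). Qed.

Lemma spnD P v w : spn P v -> spn P w -> spn P (v + w).
Proof.
move=> + Pw; elim=> [|c i u Pi _ IH]; first by rewrite add0r.
by rewrite -addrA; constructor.
Qed.

Lemma spnZ P c v : spn P v -> spn P (c *: v).
Proof.
elim=> [|d i u Pi _ IH]; first by rewrite scaler0; apply: spn0.
by rewrite scalerDr scalerA; constructor.
Qed.

Lemma spnN P v : spn P v -> spn P (- v).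
Proof. by rewrite -scaleN1r; apply: spnZ. Qed.

Lemma spnB P v w : spn P v -> spn P w -> spn P (v - w).
Proof. by move=> Pv /spnN; apply: spnD. Qed.

Lemma spn_sum P (J : Type) (r : seq J) (C : pred J) F :
  (forall j, C j -> spn P (F j)) -> spn P (\sum_(j <- r | C j) F j).
Proof.
by move=> PF; apply: big_ind => //; [exact: spn0 | exact: spnD].
Qed.

Lemma spnS P Q v : (forall i, P i -> Q i) -> spn P v -> spn Q v.
Proof. by move=> PQ; elim=> [|c i u Pi _ IH]; constructor=> //; apply: PQ. Qed.

End Span.

Lemma spn_map (K : fieldType) (V W : lmodType K) (I J : Type) (b : I -> V)
    (b' : J -> W) (P : I -> Prop) (Q : J -> Prop) (f : {linear V -> W}) v :
  (forall i, P i -> spn b' Q (f (b i))) -> spn b P v -> spn b' Q (f v).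
Proof.
move=> fP; elim=> [|c i u Pi _ IH]; first by rewrite raddf0; apply: spn0.
by rewrite linearP; apply: spnD => //; apply/spnZ/fP.
Qed.

(** The triangle i < j is reindexed by the gap k = j - i - 1. *)
Lemma exchange_triangle (V : nmodType) (f : nat -> nat -> V) a :
  \sum_(j < a.+1) \sum_(i < j) f j i =
  \sum_(k < a) \sum_(i < a - k) f (i + k.+1)%N i.
Proof.
elim: a => [|a IH]; first by rewrite big_ord1 !big_ord0.
rewrite big_ord_recr IH /= [RHS](eq_bigr (fun k : 'I_a.+1 =>
    \sum_(i < a - k) f (i + k.+1)%N i + f a.+1 (a - k)%N)) => [|k _].
  rewrite big_split /= [in RHS]big_ord_recr /= subnn big_ord0 addr0.
  by congr (_ + _); rewrite (reindex_inj rev_ord_inj).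
have le := ltn_ord k; rewrite subSn // big_ord_recr /=.
by congr (_ + f _ _); lia.
Qed.

Lemma scalE (K : fieldType) (A : comAlgType K) (a : K) (x : A) :
  a *: x = in_alg A a * x.
Proof. by rewrite mulr_algl. Qed.

Section Triangularity.
Variables (K : fieldType) (A : comAlgType K) (h G : nat -> A) (q t : K).
Variable F : nat -> A -> A.

(** [c j] is h_j[1-t]. The hypotheses below abstract the setting: [F m] gives the coefficient of
    z^(-m) in f[x + (1-t)/z] G(z), and [hG] reads H(z) G(z) = H(qz). *)
Let c j : K := if j is 0%N then 1 else 1 - t.
Definition hl (l : seq nat) : A := \prod_(a <- l) h a.

Hypothesis h0 : h 0%N = 1.
Hypothesis F1 : forall m, F m 1 = G m.
Hypothesis Fh : forall m a f,
  F m (h a * f) = \sum_(j < a.+1) c j *: (h (a - j)%N * F (m + j)%N f).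
Hypothesis hG : forall n, \sum_(i < n.+1) h (n - i)%N * G i = q ^+ n *: h n.

Let hG_tail a m : \sum_(j < a.+1) h (a - j)%N * G (m + j)%N =
  q ^+ (m + a) *: h (m + a) - \sum_(r < m) h (m + a - r)%N * G r.
Proof.
rewrite -hG -addnS big_split_ord /= [X in X - _]addrC addrK.
by apply: eq_bigr => j _; congr (h _ * _); lia.
Qed.

Let sum_c a (y : nat -> A) : \sum_(j < a.+1) c j *: (h (a - j)%N * y j) =
  (1 - t) *: (\sum_(j < a.+1) h (a - j)%N * y j) + t *: (h a * y 0%N).
Proof.
rewrite !big_ord_recl /= !subn0 scale1r scalerDr -scaler_sumr.
by rewrite addrAC -scalerDl subrK scale1r.
Qed.

(* One step of the expansion of [F m (hl l)] in raised products: [C] collects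
   the terms produced by the truncated part of the series of the [G r]. *)
Let rec a f (x : K) (C : nat -> A) (u : K) (B : nat -> A) m : A :=
  \sum_(j < a.+1) c j *: (h (a - j)%N * B (m + j)%N) +
  (1 - t) *: ((x * u ^+ (m + a)) *: (f * h (m + a)) -
    \sum_(k < a) u ^+ (m + (a - k.+1)) *: (C k.+1 * h (m + (a - k.+1)))).

(** The expansion keeps its shape when a factor h_a is added. Indices r < m form a truncated
    convolution again; the others are summed by [hG_tail], whose closed part carries a power of q
    and whose correction carries none. Hence the new B and C are [rec] with u = q and u = 1. *)
Let rec_step a f x B C :
    (forall m, F m f =
      B m - \sum_(r < m) G r * C (m - r)%N + x *: (f * G m)) ->
  forall m, F m (h a * f) = rec a f x C q B m
    - \sum_(r < m) G r * rec a f x C 1 C (m - r) + (t * x) *: (h a * f * G m).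
Proof.
move=> IH m; rewrite Fh.
(* [g j] collects the terms r = m + i of the convolution at [m + j], those beyond the truncation at
   m. *)
pose g j := \sum_(i < j) G (m + i)%N * C (j - i)%N.
have -> : \sum_(j < a.+1) c j *: (h (a - j)%N * F (m + j) f) =
    \sum_(j < a.+1) c j *: (h (a - j)%N * B (m + j)%N)
    - \sum_(r < m) G r * (\sum_(j < a.+1) c j *: (h (a - j)%N * C (m - r + j)%N))
    - \sum_(j < a.+1) c j *: (h (a - j)%N * g j)
    + x *: (f * \sum_(j < a.+1) c j *: (h (a - j)%N * G (m + j)%N)).
  rewrite [in X in _ - X - _ + _](eq_bigr _ (fun r _ => mulr_sumr _ _ _ _)).
  rewrite exchange_big /= mulr_sumr scaler_sumr -!sumrB -big_split /=.
  apply: eq_bigr => j _; rewrite IH big_split_ord /=.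
  have -> : \sum_(i < j) G (m + i)%N * C (m + j - (m + i))%N = g j.
    by apply: eq_bigr => i _; rewrite subnDl.
  have -> : \sum_(i < m) G i * (c j *: (h (a - j) * C (m - i + j)%N)) =
      c j *: (h (a - j)%N * \sum_(i < m) G i * C (m + j - i)%N).
    rewrite mulr_sumr scaler_sumr; apply: eq_bigr => i _.
    rewrite -scalerAr; congr (_ *: _); rewrite mulrCA; congr (_ * (_ * C _)).
    by have := ltn_ord i; lia.
  by rewrite !scalE; ring.
rewrite (sum_c a g) (sum_c a (fun j => G (m + j)%N)) addn0 hG_tail.
rewrite /g big_ord0 mulr0 scaler0 addr0.
(* Grouping by the index k+1 of C makes each inner sum a tail of the convolution with G. *)
have -> : \sum_(j < a.+1) h (a - j)%N * (\sum_(i < j) G (m + i)%N * C (j - i)%N) =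
    \sum_(k < a) q ^+ (m + (a - k.+1)) *: (C k.+1 * h (m + (a - k.+1)))
    - \sum_(k < a) C k.+1 * \sum_(r < m) h (m + (a - k.+1) - r)%N * G r.
  under eq_bigr do rewrite mulr_sumr.
  rewrite (exchange_triangle
    (fun j i => h (a - j)%N * (G (m + i)%N * C (j - i)%N))).
  rewrite -sumrB; apply: eq_bigr => k _.
  rewrite scalerAr -mulrBr -hG_tail mulr_sumr.
  have -> : (a - k.+1).+1 = (a - k)%N by have := ltn_ord k; lia.
  apply: eq_bigr => i _; rewrite mulrA mulrC; congr (C _ * (h _ * _)); lia.
have -> : \sum_(r < m) G r * rec a f x C 1 C (m - r) =
    \sum_(r < m) G r * (\sum_(j < a.+1) c j *: (h (a - j)%N * C (m - r + j)%N))
    + (1 - t) *: (x *: (f * \sum_(r < m) h (m + a - r)%N * G r)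
      - \sum_(k < a) C k.+1 * \sum_(r < m) h (m + (a - k.+1) - r)%N * G r).
  rewrite [in X in (1 - t) *: (_ - X)](eq_bigr _ (fun k _ => mulr_sumr _ _ _ _)).
  rewrite exchange_big /= mulr_sumr scaler_sumr -sumrB scaler_sumr -big_split.
  apply: eq_bigr => r _; rewrite /rec mulrDr; congr (_ + _).
  rewrite -scalerAr; congr (_ *: _); rewrite mulrBr expr1n mulr1 -scalerAr.
  congr (_ *: _ - _).
    have -> : (m - r + a = m + a - r)%N by have := ltn_ord r; lia.
    by ring.
  rewrite mulr_sumr; apply: eq_bigr => k _; rewrite expr1n scale1r.
  have -> : (m - r + (a - k.+1) = m + (a - k.+1) - r)%N.
    by have := ltn_ord r; lia.
  by ring.
rewrite /rec.
by rewrite !scalE; ring.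
Qed.

(** Boxes of l move to earlier parts and m boxes are added; mu may be unsorted and contain zeros. *)
Definition raises (l : seq nat) m (mu : seq nat) : Prop :=
  [/\ size mu = size l,
      forall k, (sumn (take k l) <= sumn (take k mu))%N &
      sumn mu = (sumn l + m)%N].

Let raises_rcons l a m x m' mu : raises l m' mu -> (x + m' = a + m)%N ->
  raises (rcons l a) m (rcons mu x).
Proof.
move=> [sz dom sm] e; split; first by rewrite !size_rcons sz.
  move=> k; have [le|lt] := leqP k (size l).
    by rewrite -!cats1 !takel_cat ?sz.
  by rewrite !take_oversize ?size_rcons ?sz // -!cats1 !sumn_cat sm /=; lia.
by rewrite -!cats1 !sumn_cat sm /=; lia.
Qed.

Let hl_rcons l a : hl (rcons l a) = h a * hl l.
Proof. by rewrite /hl -cats1 big_cat big_seq1 mulrC. Qed.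

Let spn_rcons l a m x m' (P Q : seq nat -> Prop) f :
    (forall mu, P mu -> Q (rcons mu x)) ->
    (x + m' = a + m)%N -> spn hl (fun mu => raises l m' mu /\ P mu) f ->
  spn hl (fun mu => raises (rcons l a) m mu /\ Q mu) (h x * f).
Proof.
move=> PQ e; elim=> [|d mu v [Pmu Qmu] _ IH]; first by rewrite mulr0; apply: spn0.
rewrite mulrDr -scalerAr -hl_rcons; apply: spnD => //; apply/spnZ/spn_b.
by split; [apply: raises_rcons Pmu e | apply: PQ].
Qed.

(** [eigenvalueE] turns t^(size l) + (1-t) times this sum into 1 - M B_l. *)
Definition mac_eig (l : seq nat) : K :=
  \sum_(i < size l) t ^+ i * q ^+ nth 0%N l i.

Let mac_eig_rcons l a : mac_eig (rcons l a) = mac_eig l + t ^+ size l * q ^+ a.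
Proof.
rewrite /mac_eig size_rcons big_ord_recr /= nth_rcons ltnn eqxx.
by congr (_ + _); apply: eq_bigr => i _; rewrite nth_rcons ltn_ord.
Qed.

Let raises_refl l : raises l 0 l.
Proof. by split=> //; rewrite addn0. Qed.

Let spnT l m f : spn hl (raises l m) f ->
  spn hl (fun mu => raises l m mu /\ True) f.
Proof. exact: spnS. Qed.

(** Induction on l by appending a last part, through [rec_step]. A diagonal contribution to B 0 must
    keep the last part unchanged; all terms that shorten it are proper raises. *)
Let F_hl_expand l : exists B C : nat -> A,
  [/\ forall m, F m (hl l) =
        B m - \sum_(r < m) G r * C (m - r)%N + t ^+ size l *: (hl l * G m),
      forall m, spn hl (raises l m) (B m),
      forall m, spn hl (raises l m) (C m) &
      spn hl (fun mu => raises l 0 mu /\ mu <> l)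
        (B 0%N - ((1 - t) * mac_eig l) *: hl l)].
Proof.
elim/last_ind: l => [|l a [B [C [FE RB RC dB]]]].
  exists (fun=> 0), (fun=> 0); split=> [m|m|m|]; try exact: spn0.
    rewrite /hl big_nil F1 mul1r scale1r big1 ?subrr ?add0r // => r _.
    exact: mulr0.
  by rewrite /mac_eig big_ord0 mulr0 scale0r subrr; exact: spn0.
pose x := t ^+ size l.
have Rrec (u : K) X m : (forall m, spn hl (raises l m) (X m)) ->
    spn hl (raises (rcons l a) m) (rec a (hl l) x C u X m).
  move=> RX; apply: (@spnS _ _ _ _ (fun mu => raises (rcons l a) m mu /\ True)).
    by move=> i [].
  apply: spnD.
    apply: spn_sum => j _; apply: spnZ.
    apply: spn_rcons (spnT (RX _)) => //.
    by have := ltn_ord j; lia.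
  apply/spnZ/spnB.
    apply: spnZ; rewrite mulrC; apply: (@spn_rcons _ _ _ _ 0 (fun=> True)) => //.
      by lia.
    exact/spnT/spn_b/raises_refl.
  apply: spn_sum => k _; apply: spnZ; rewrite mulrC.
  apply: spn_rcons (spnT (RC _)) => //.
  by have := ltn_ord k; lia.
exists (rec a (hl l) x C q B), (rec a (hl l) x C 1 C); split.
- by move=> m; rewrite hl_rcons (rec_step a FE) size_rcons exprS.
- by move=> m; apply: Rrec.
- by move=> m; apply: Rrec.
(* The j = 0 term and x q^a supply the new diagonal coefficient. What remains is h_a times the
   previous defect and products whose last part is smaller than a. *)
have -> : rec a (hl l) x C q B 0 - ((1 - t) * mac_eig (rcons l a)) *: hl (rcons l a)
  = h a * (B 0%N - ((1 - t) * mac_eig l) *: hl l)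
    + \sum_(j < a) (1 - t) *: (h (a - j.+1)%N * B j.+1)
    - (1 - t) *: \sum_(k < a) q ^+ (a - k.+1) *: (h (a - k.+1)%N * C k.+1).
  rewrite /rec big_ord_recl subn0 scale1r mac_eig_rcons hl_rcons -/x !add0n.
  under [X in _ *: (_ - X)]eq_bigr do rewrite add0n mulrC.
  rewrite [X in _ + X + _](eq_bigr
    (fun j : 'I_a => (1 - t) *: (h (a - j.+1)%N * B j.+1))) //.
  by rewrite !scalE; ring.
apply: spnB; first apply: spnD.
- by apply: spn_rcons dB => // mu ne /rcons_inj[].
- apply: spn_sum => j _; apply: spnZ; apply: spn_rcons (spnT (RB _)) => //.
    by move=> mu _ /rcons_inj[_]; have := ltn_ord j; lia.
  by have := ltn_ord j; lia.
- apply/spnZ/spn_sum => j _; apply: spnZ; apply: spn_rcons (spnT (RC _)) => //.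
    by move=> mu _ /rcons_inj[_]; have := ltn_ord j; lia.
  by have := ltn_ord j; lia.
Qed.

Lemma hl_cons a l : hl (a :: l) = h a * hl l.
Proof. exact: big_cons. Qed.

Lemma hl1 a : hl [:: a] = h a.
Proof. exact: big_seq1. Qed.

Lemma F_hl_triangular l :
  spn hl (fun mu => raises l 0 mu /\ mu <> l)
    (F 0 (hl l) - (t ^+ size l + (1 - t) * mac_eig l) *: hl l).
Proof.
have [B [C [-> _ _]]] := F_hl_expand l.
have -> : G 0%N = 1 by have := hG 0; rewrite big_ord1 scale1r h0 mul1r.
rewrite big_ord0 subr0 mulr1 => dB.
set f := (X in spn _ _ X); suff -> : f = B 0%N - ((1 - t) * mac_eig l) *: hl l by [].
by rewrite /f !scalE; ring.
Qed.

End Triangularity.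

(** * Partitions and dominance *)

Section Partitions.
Local Open Scope nat_scope.
Implicit Types (l m la mu nu : seq nat).

Lemma sumn_takeS l k : sumn (take k.+1 l) = sumn (take k l) + nth 0 l k.
Proof.
have [lt|le] := ltnP k (size l).
  by rewrite (take_nth 0 lt) sumn_rcons.
by rewrite !take_oversize ?nth_default ?addn0 // leqW.
Qed.

Lemma eq_sumn_take l m : (forall k, sumn (take k l) = sumn (take k m)) ->
  forall k, nth 0 l k = nth 0 m k.
Proof.
by move=> H k; have := H k.+1; rewrite !sumn_takeS H => /addnI.
Qed.

Lemma eq_from_nth_pos l m : 0 \notin l -> 0 \notin m ->
  (forall k, nth 0 l k = nth 0 m k) -> l = m.
Proof.
have size_le (l1 l2 : seq nat) : 0 \notin l1 ->
    (forall k, nth 0 l1 k = nth 0 l2 k) -> size l1 <= size l2.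
  move=> l0 H; rewrite leqNgt; apply: contra l0 => lt.
  by rewrite -(nth_default 0 (leqnn (size l2))) -H mem_nth.
move=> l0 m0 H; apply: (@eq_from_nth _ 0) => [|k _]; last exact: H.
by apply/eqP; rewrite eqn_leq !size_le.
Qed.

(** Each entry is at most c plus its excess over c. For sorted lists equality holds at c = entry k
    ([sumn_take_sorted]), and for given c at some k ([sumn_take_level]). Dominance thus becomes a
    comparison of excess sums, which ignore the order of the entries. *)
Lemma sumn_take_excess c k l :
  sumn (take k l) <= k * c + \sum_(x <- l) (x - c).
Proof.
elim: l k => [|x l IH] [|k] //=; rewrite big_cons; have := IH k; lia.
Qed.

Lemma geq_trans : transitive geq.
Proof. by move=> a b c /= ba ac; apply: leq_trans ac ba. Qed.

Lemma sumn_take_sorted k l : sorted geq l ->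
  sumn (take k l) = k * nth 0 l k + \sum_(x <- l) (x - nth 0 l k).
Proof.
elim: l k => [|x l IH] [|k] srt /=; rewrite ?big_nil ?muln0 ?mul0n //.
  rewrite add0n big_seq big1 // => y.
  rewrite inE => /predU1P[->|yl]; first by rewrite subnn.
  by have /allP /(_ y yl) /= := order_path_min geq_trans srt; lia.
rewrite big_cons IH ?(path_sorted srt) //.
suff : nth 0 l k <= x by lia.
have [lt|le] := ltnP k (size l); last by rewrite nth_default.
exact: (allP (order_path_min geq_trans srt)) (mem_nth 0 lt).
Qed.

Lemma sumn_take_level c l : sorted geq l ->
  exists k, sumn (take k l) = k * c + \sum_(x <- l) (x - c).
Proof.
elim: l => [|x l IH] srt; first by exists 0; rewrite big_nil.
have [le|gt] := leqP x c; last first.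
  have [k e] := IH (path_sorted srt); exists k.+1.
  by rewrite /= big_cons e; lia.
exists 0; rewrite add0n big_seq big1 // => y.
rewrite inE => /predU1P[->|yl]; first exact/eqP.
by have /allP /(_ y yl) /= := order_path_min geq_trans srt; lia.
Qed.

Lemma sumn_take_le l m : sorted geq m ->
    (forall c, \sum_(x <- l) (x - c) <= \sum_(x <- m) (x - c)) ->
  forall k, sumn (take k l) <= sumn (take k m).
Proof.
move=> srt H k; rewrite (sumn_take_sorted k srt).
by apply: leq_trans (sumn_take_excess (nth 0 m k) k l) _; rewrite leq_add2l.
Qed.

(** Sorting and dropping zeros leaves the product of the h_a unchanged, as h_0 = 1. *)
Definition partition_of l := sort geq (filter (fun x => 0 < x) l).

Lemma partition_of_intpart l : is_intpart (partition_of l).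
Proof.
rewrite /is_intpart /partition_of sort_sorted /= => [|a b /=]; last exact: leq_total.
by rewrite mem_sort mem_filter.
Qed.

Lemma big_partition_of (R : Type) (idx : R) (op : Monoid.com_law idx)
    (F : nat -> R) l : F 0 = idx ->
  \big[op/idx]_(x <- partition_of l) F x = \big[op/idx]_(x <- l) F x.
Proof.
move=> F0; rewrite (perm_big _ (permEl (perm_sort _ _))) big_filter.
rewrite big_mkcond; apply: eq_bigr => x _.
by case: x => //=; rewrite F0.
Qed.

Lemma sumn_partition_of l : sumn (partition_of l) = sumn l.
Proof. by rewrite !sumnE big_partition_of. Qed.

Lemma sumn_take_partition_of l k :
  sumn (take k l) <= sumn (take k (partition_of l)).
Proof.
apply: sumn_take_le => [|c]; last by rewrite big_partition_of.
by have /andP[] := partition_of_intpart l.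
Qed.

Lemma intpart_sorted (mu : intpart) : sorted geq mu.
Proof. by case: mu => mu /= /andP[]. Qed.

Lemma intpart_pos (mu : intpart) : 0 \notin (mu : seq nat).
Proof. by case: mu => mu /= /andP[]. Qed.

Lemma intpart_eq (la mu : intpart) :
  (forall k, sumn (take k la) = sumn (take k mu)) -> la = mu.
Proof.
move=> H; apply: val_inj; apply: eq_from_nth_pos; try exact: intpart_pos.
exact: eq_sumn_take.
Qed.

Lemma dominates_trans mu la nu :
  dominates la mu -> dominates mu nu -> dominates la nu.
Proof.
move=> [s1 d1] [s2 d2]; split=> [|k]; first by rewrite s1.
exact: leq_trans (d2 k) (d1 k).
Qed.

Lemma dominates_anti (la mu : intpart) :
  dominates la mu -> dominates mu la -> la = mu.
Proof.
move=> [_ d1] [_ d2]; apply: intpart_eq => k.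
by apply/eqP; rewrite eqn_leq d1 d2.
Qed.

(** Induction from the top of the dominance order. The weight [wt] adds, over k, the boxes outside
    the first k rows; it drops strictly on going up. *)
Lemma dominates_ind (P : intpart -> Prop) :
    (forall mu : intpart,
      (forall la : intpart, dominates la mu -> la <> mu -> P la) -> P mu) ->
  forall mu : intpart, P mu.
Proof.
move=> IH mu; pose wt (la : intpart) :=
  \sum_(k < (sumn mu).+1) (sumn mu - sumn (take k la)).
suff main N (nu : intpart) : sumn nu = sumn mu -> wt nu < N -> P nu.
  exact: (main (wt mu).+1).
elim: N nu => // N IHN nu snu le.
apply: IH => la [sla dla] ne; apply: IHN; first by rewrite sla.
suff : wt la < wt nu by lia.
(* A partition of N has at most N parts, so distinct ones already differ in a partial sum that [wt]
   sees. *)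
have take_all (x : intpart) k : sumn x = sumn mu -> sumn mu <= k ->
    sumn (take k x) = sumn mu.
  move=> sx lk; rewrite take_oversize //; apply: leq_trans lk; rewrite -sx.
  have := intpart_pos x; elim: (x : seq nat) => //= a l IHl.
  by rewrite inE negb_or => /andP[a0 /IHl]; lia.
have [k dk] : exists k : 'I_(sumn mu).+1, sumn (take k nu) < sumn (take k la).
  apply/existsP; apply: contra_notT ne; rewrite negb_exists => /forallP H.
  apply: intpart_eq => k; have [lt|gt] := ltnP k (sumn mu).+1.
    have := H (Ordinal lt); rewrite -leqNgt /= => le'.
    by apply/eqP; rewrite eqn_leq le' dla.
  by rewrite !take_all ?sla // ltnW.
rewrite /wt (bigD1 k) //= [X in _ < X](bigD1 k) //= -addSn leq_add //.
  have := congr1 sumn (cat_take_drop k la); rewrite sumn_cat sla snu.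
  by lia.
by apply: leq_sum => i _; have := dla i; lia.
Qed.

(** Both sides say that the cell (i,j) lies in the diagram. *)
Lemma count_gt_nth mu i j : sorted geq mu ->
  (i < count (fun r => j < r) mu) = (j < nth 0 mu i).
Proof.
elim: mu i => [|x mu IH] i srt; first by rewrite nth_nil.
have cnt0 : x <= j -> count (fun r => j < r) mu = 0.
  move=> le; apply/eqP; rewrite -leqn0 leqNgt -has_count; apply/hasPn => y ymu.
  rewrite -leqNgt; apply: leq_trans le.
  exact: (allP (order_path_min geq_trans srt)).
have := IH _ (path_sorted srt).
case: i => [|i] IHi /=; case: (ltnP j x) => [gt|le] /=; rewrite ?add1n ?ltnS //.
  by rewrite cnt0.
by rewrite -IHi cnt0.
Qed.

Lemma head_max mu x : sorted geq mu -> x \in mu -> x <= head 0 mu.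
Proof.
case: mu => //= y mu srt; rewrite inE => /predU1P[->//|xmu].
exact: (allP (order_path_min geq_trans srt)).
Qed.

Lemma nth_conj mu j : sorted geq mu ->
  nth 0 (conj_part mu) j = count (fun r => j < r) mu.
Proof.
move=> srt; have [lt|le] := ltnP j (head 0 mu); first by rewrite nth_mkseq.
rewrite nth_default ?size_mkseq //; apply/esym/eqP.
rewrite -leqn0 leqNgt -has_count; apply/hasPn => x xmu.
by rewrite -leqNgt; apply: leq_trans le; apply: head_max.
Qed.

Lemma conj_intpart (mu : intpart) : is_intpart (conj_part mu).
Proof.
have srt := intpart_sorted mu; apply/andP; split.
  apply/(sortedP 0) => i; rewrite size_mkseq => lt.
  rewrite !nth_conj //; apply: sub_count => r /=; lia.
apply/(nthP 0) => -[j]; rewrite size_mkseq => lt; rewrite nth_mkseq //.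
by apply/eqP; rewrite -lt0n count_gt_nth.
Qed.

Lemma count_ltn_iota n k : k <= n -> count (fun j => j < k) (iota 0 n) = k.
Proof.
move=> le; rewrite -(subnKC le) iotaD count_cat add0n.
rewrite (eq_in_count (a2 := xpredT)) => [|j]; last by rewrite mem_iota => /andP[].
rewrite count_predT size_iota (eq_in_count (a2 := pred0)) ?count_pred0 ?addn0 //.
by move=> j; rewrite mem_iota => /andP[] ? _ /=; apply/negbTE; rewrite -leqNgt.
Qed.

Lemma conj_partK (mu : intpart) : conj_part (conj_part mu) = mu.
Proof.
have srt := intpart_sorted mu.
pose mu' := IntPart (conj_intpart mu).
apply: eq_from_nth_pos; try exact: intpart_pos.
  by have /andP[] := conj_intpart mu'.
move=> i; rewrite (nth_conj _ (intpart_sorted mu')) /= count_map.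
rewrite -[RHS](@count_ltn_iota (head 0 mu)).
  by apply: eq_count => j /=; rewrite count_gt_nth.
have [lt|le] := ltnP i (size mu); last by rewrite nth_default.
by apply: head_max srt _; exact: mem_nth.
Qed.

(** Double counting of the cells in the first k columns, with weight F j in column j. *)
Lemma sum_conj_part (F : nat -> nat) mu k : sorted geq mu ->
  \sum_(j < k) F j * nth 0 (conj_part mu) j =
  \sum_(x <- mu) \sum_(j < minn x k) F j.
Proof.
move=> srt; transitivity (\sum_(j < k) \sum_(x <- mu) F j * (j < x)).
  by apply: eq_bigr => j _; rewrite nth_conj // -big_distrr -sum1_count big_mkcond.
rewrite exchange_big /=; apply: eq_bigr => x _.
rewrite (big_ord_widen k F (geq_minr x k)) [RHS]big_mkcond /=.
apply: eq_bigr => j _; rewrite leq_min ltn_ord andbT.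
by case: ifP; rewrite ?muln1 ?muln0.
Qed.

Lemma sumn_take_nth l k : sumn (take k l) = \sum_(j < k) nth 0 l j.
Proof.
by elim: k => [|k IH]; rewrite ?take0 ?big_ord0 // sumn_takeS big_ord_recr IH.
Qed.

Lemma sumn_take_conj mu k : sorted geq mu ->
  sumn (take k (conj_part mu)) = \sum_(x <- mu) minn x k.
Proof.
move=> srt; rewrite sumn_take_nth.
transitivity (\sum_(j < k) 1 * nth 0 (conj_part mu) j).
  by apply: eq_bigr => j _; rewrite mul1n.
rewrite (sum_conj_part (fun=> 1)) //.
by apply: eq_bigr => x _; rewrite sum_nat_const card_ord muln1.
Qed.

Lemma nstat_conj mu : sorted geq mu ->
  nstat (conj_part mu) = \sum_(x <- mu) \sum_(j < x) j.
Proof.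
move=> srt; rewrite /nstat size_mkseq (sum_conj_part id) //.
rewrite big_seq [RHS]big_seq; apply: eq_bigr => x xmu.
by have /minn_idPl -> := head_max srt xmu.
Qed.

(** Conjugation reverses dominance: the first k columns hold the size minus the excess over k, and
    the excess grows with dominance. So both conjugates have the same partial sums. *)
Lemma dominates_conj_anti (nu mu : intpart) : dominates nu mu ->
  dominates (conj_part nu) (conj_part mu) -> nu = mu.
Proof.
move=> [s1 d1] [_ d2].
have srtn := intpart_sorted nu; have srtm := intpart_sorted mu.
have excess k : \sum_(x <- mu) (x - k) <= \sum_(x <- nu) (x - k).
  have [i e] := sumn_take_level k srtm.
  by have := sumn_take_excess k i nu; have := d1 i; lia.
have split_min (l : seq nat) k : \sum_(x <- l) minn x k + \sum_(x <- l) (x - k) = sumn l.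
  by rewrite -big_split sumnE; apply: eq_bigr => x _ /=; lia.
have e : conj_part nu = conj_part mu.
  suff tk k : sumn (take k (conj_part nu)) = sumn (take k (conj_part mu)).
    pose c (la : intpart) := IntPart (conj_intpart la).
    by have /(congr1 parts) := @intpart_eq (c nu) (c mu) tk.
  apply: anti_leq; rewrite d2 andbT !sumn_take_conj //.
  by have := excess k; have := split_min nu k; have := split_min mu k; lia.
by apply: val_inj; rewrite /= -(conj_partK nu) e conj_partK.
Qed.

End Partitions.

(** * Macdonald polynomials as eigenvectors *)

Lemma spn_trans (K : fieldType) (V : lmodType K) (I J : Type) (b : I -> V)
    (b' : J -> V) (P : I -> Prop) (Q : J -> Prop) v :
  (forall i, P i -> spn b' Q (b i)) -> spn b P v -> spn b' Q v.
Proof.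
move=> bQ; elim=> [|c i u Pi _ IH]; first exact: spn0.
by apply: spnD => //; apply/spnZ/bQ.
Qed.

Lemma spn_split (K : fieldType) (V : lmodType K) (I : eqType) (b : I -> V)
    (P : I -> Prop) (i0 : I) v : spn b P v ->
  exists a w, v = a *: b i0 + w /\ spn b (fun i => P i /\ i <> i0) w.
Proof.
elim=> [|c i u Pi _ [a [w [-> Pw]]]].
  by exists 0, 0; split; [rewrite scale0r addr0 | exact: spn0].
have [->|/eqP ne] := eqVneq i i0.
  by exists (c + a), w; split=> //; rewrite scalerDl addrA.
exists a, (c *: b i + w); split; first by rewrite addrCA.
by apply: spnD => //; apply/spnZ/spn_b.
Qed.

(** * Spans inside a basis *)

Section Basis.
Variables (K : fieldType) (I : choiceType) (b : I -> Lam K).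

Let ev (c : {malg K[I]}) : Lam K :=
  \sum_(i <- monalg.msupp c) monalg.mcoeff i c *: b i.

Let evw (c : {malg K[I]}) (d : {fset I}) : (monalg.msupp c `<=` d)%fset ->
  ev c = \sum_(i <- d) monalg.mcoeff i c *: b i.
Proof.
move=> le; apply: big_fset_incl => // i _ /mcoeff_outdom ->.
by rewrite scale0r.
Qed.

Lemma spn_malg (P : I -> Prop) f : spn b P f ->
  exists c : {malg K[I]},
    (forall i, i \in monalg.msupp c -> P i) /\
    f = \sum_(i <- monalg.msupp c) monalg.mcoeff i c *: b i.
Proof.
elim=> [|a i u Pi _ [c [Pc ->]]].
  by exists 0; split=> [i|]; rewrite msupp0 ?inE // big_seq_fset0.
exists (<< a *g i >> + c); split=> [j|].
  move=> /(fsubsetP (monalg.msuppD_le _ _)); rewrite in_fsetU => /orP[|/Pc//].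
  by move=> /(fsubsetP msuppU_le); rewrite in_fset1 => /eqP ->.
pose d := (i |` monalg.msupp c)%fset.
suff e : ev (<< a *g i >> + c) = a *: b i + ev c by exact: esym e.
rewrite (@evw (<< a *g i >> + c) d); last first.
  apply: fsubset_trans (monalg.msuppD_le _ _) _.
  by apply: fsetSU; exact: msuppU_le.
rewrite (@evw c d) ?fsubsetUr //.
have -> : a *: b i = \sum_(j <- d) monalg.mcoeff j << a *g i >> *: b j.
  rewrite (big_fsetD1 i) ?fset1U1 //= mcoeffUU big_seq big1 ?addr0 // => j.
  rewrite in_fsetD1 => /andP[ne _]; rewrite monalg.mcoeffU eq_sym.
  by rewrite (negbTE ne) mulr0n scale0r.
rewrite -big_split; apply: eq_bigr => j _.
by rewrite monalg.mcoeffD scalerDl.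
Qed.

Hypothesis basis_b : is_basis b.

Lemma spn_full f : spn b (fun=> True) f.
Proof.
have [c [-> _]] := basis_b f; apply: spn_sum => i _; exact/spnZ/spn_b.
Qed.

(** Coefficients in a basis are unique, so the two expansions coincide and their support satisfies
    both conditions. *)
Lemma spn_cap (P Q : I -> Prop) f :
  spn b P f -> spn b Q f -> spn b (fun i => P i /\ Q i) f.
Proof.
move=> /spn_malg[c [Pc cE]] /spn_malg[c' [Qc c'E]].
have [c0 [_ uniq]] := basis_b f.
have e : c = c' by rewrite -(uniq _ cE) (uniq _ c'E).
rewrite cE big_seq; apply: spn_sum => i ic; apply/spnZ/spn_b.
by split; [exact: Pc | apply: Qc; rewrite -e].
Qed.

Lemma spn_disjoint (P Q : I -> Prop) f : (forall i, P i -> ~ Q i) ->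
  spn b P f -> spn b Q f -> f = 0.
Proof.
move=> PQ Pf Qf; elim: (spn_cap Pf Qf) => // c i u [Pi Qi].
by case: (PQ i Pi).
Qed.

Lemma basis_neq0 i : b i != 0.
Proof.
apply/eqP => bi0; have [c0 [_ uniq]] := basis_b 0.
have e0 : c0 = 0 by apply: uniq; rewrite msupp0 big_seq_fset0.
have e1 : c0 = << i >>.
  by apply: uniq; rewrite msuppU oner_eq0 big_seq_fset1 bi0 scaler0.
have /(congr1 (monalg.mcoeff i)) : << i >> = 0 :> {malg K[I]} by rewrite -e1.
by rewrite mcoeffUU monalg.mcoeff0 => /eqP; rewrite oner_eq0.
Qed.

End Basis.

(** * Complete products: triangularity of E(q,t) and expansion of Schur functions *)

Section CompleteProducts.
Variable K : fieldType.
Hypothesis pcharK0 : [pchar K] =i pred0.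
Local Notation Lam := (Lam K).
#[local] Opaque p h e scl psi.

Definition hI (la : intpart) : Lam := hl h la.

Lemma hl_partition_of l :
  hl (h : nat -> Lam) l = hI (IntPart (partition_of_intpart l)).
Proof. by rewrite /hI /= /hl big_partition_of //; exact: h0. Qed.

Lemma raises_dominates (l : intpart) mu : raises l 0 mu ->
  dominates (partition_of mu) l.
Proof.
move=> [_ dom sm]; split=> [|k]; first by rewrite sumn_partition_of sm addn0.
exact: leq_trans (dom k) (sumn_take_partition_of mu k).
Qed.

(** Partial sums of mu lie between those of l and those of mu sorted; if the sorted form is l, they
    agree and mu = l. *)
Lemma raises_neq (l : intpart) mu : raises l 0 mu -> mu <> l ->
  IntPart (partition_of_intpart mu) <> l.
Proof.
move=> [sz dom sm] ne /(congr1 parts) /= e; apply: ne.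
have H := @eq_sumn_take mu l; apply: (@eq_from_nth _ 0%N) => // k _.
apply: H => {}k; apply/eqP; rewrite eqn_leq dom andbT -e.
exact: sumn_take_partition_of.
Qed.

Lemma newton_Bgeom (c d : K) : newton (fun k => c ^+ k - d ^+ k)
  (fun j => if j is i.+1 then c ^+ i * (c - d) else 1).
Proof.
apply: newton_ext (newton_conv (newton_geom c) (newton_neg_geom d)) => // n.
case: n => [|n]; first by rewrite big_ord1 mulr1.
rewrite (big_ord_recr n.+1) /= subnn mulr1 (big_ord_recr n) /= subSnn.
rewrite big1 ?add0r => [|i _]; first by rewrite exprS; ring.
have -> : (n.+1 - i = (n - i.+1).+2)%N by have := ltn_ord i; lia.
by rewrite mulr0.
Qed.

Lemma newton_1Bgeom (c : K) : newton (fun k => 1 - c ^+ k)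
  (fun j => if j is 0%N then 1 else 1 - c).
Proof.
apply: newton_ext (newton_Bgeom 1 c) => [k _|[|j] //]; first by rewrite expr1n.
by rewrite expr1n mul1r.
Qed.

(** The addition formula for x + (c-1)x = cx; it provides the hypothesis [hG]. *)
Lemma sum_h_geomB (c : K) n :
  \sum_(i < n.+1) h (n - i) * scl (fun k => c ^+ k - 1) (h i) = c ^+ n *: h n.
Proof.
rewrite -(scl_geom_h pcharK0).
rewrite -(scl_conv pcharK0 (u := fun k => c ^+ k - 1) (v := fun=> 1)).
  by apply: eq_bigr => i _; rewrite mulrC [scl _ (h (n - i))]scl_id.
by move=> k _; rewrite subrK.
Qed.

(* [scl (fun k => q ^+ k - 1) (h j)] is h_j[(q-1)x], the coefficient of z^j in
   Exp[-z(1-q)x]. *)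
Definition opE (q t : K) := opD (fun k => 1 - t ^+ k)
  (fun j => scl (fun k => q ^+ k - 1) (h j)) 0.

Lemma opE_triangular (q t : K) (la : intpart) :
  spn hI (fun mu => dominates mu la /\ mu <> la)
    (opE q t (hI la) - (t ^+ size la + (1 - t) * mac_eig q t la) *: hI la).
Proof.
pose G j : Lam := scl (fun k => q ^+ k - 1) (h j).
have := @F_hl_triangular K Lam h G q t (opD (fun k => 1 - t ^+ k) G) (h0 K).
move=> /(_ (opD1 _ _)) /(_ (fun m a f =>
  opD_h pcharK0 G m a f (newton_1Bgeom t))) H.
have {}H := H (sum_h_geomB q) la; apply: spn_trans H.
move=> mu [rmu ne]; rewrite hl_partition_of; apply: spn_b; split.
  exact: raises_dominates.
exact: raises_neq.
Qed.

(** The shortfalls k - w i over i < k add up to at most the total shortfall over all i, which w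
    permutes into that of the identity. *)
Lemma sum_perm_ge l (w : 'S_l) k : (k <= l)%N ->
  (\sum_(i < l | i < k) i <= \sum_(i < l | i < k) w i)%N.
Proof.
move=> le.
have wid (F : nat -> nat) : (\sum_(i < l | i < k) F i = \sum_(i < k) F i)%N.
  by rewrite (big_ord_widen l F le).
have e1 : (\sum_(i < l | i < k) (i + (k - i)) = k * k)%N.
  rewrite (wid (fun i => i + (k - i))%N); transitivity (\sum_(i < k) k)%N.
    by apply: eq_bigr => i _; have := ltn_ord i; lia.
  by rewrite sum_nat_const card_ord.
have e2 : (k * k <= \sum_(i < l | i < k) (w i + (k - w i)))%N.
  have -> : (k * k = \sum_(i < l | i < k) k)%N.
    by rewrite (wid (fun=> k)) sum_nat_const card_ord.
  by apply: leq_sum => i _; lia.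
have e3 : (\sum_(i < l | i < k) (k - w i) <= \sum_(i < l | i < k) (k - i))%N.
  have -> : (\sum_(i < l | i < k) (k - i) = \sum_(i < l) (k - w i))%N.
    rewrite -(reindex_inj (@perm_inj _ w) (P := predT)
      (F := fun i : 'I_l => (k - i)%N)) /=.
    rewrite big_mkcond; apply: eq_bigr => i _; case: ltnP => // ?.
    by apply/esym/eqP; lia.
  rewrite [X in (X <= _)%N]big_mkcond; apply: leq_sum => i _.
  by case: ifP.
rewrite -(leq_add2r (\sum_(i < l | i < k) (k - i))%N) -big_split e1.
by apply: leq_trans e2 _; rewrite big_split leq_add2l.
Qed.

(** In the Jacobi-Trudi determinant, w contributes up to sign the product of the h_(la_i - i +
    w(i)), or 0 if an index is negative. By [sum_perm_ge] its partial sums are at least those of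
    la. *)
Lemma spn_schur (la : intpart) : spn hI (fun mu => dominates mu la) (s la).
Proof.
rewrite /s /determinant; apply: spn_sum => w _.
rewrite mulr_sign -scaler_sign; apply: spnZ.
pose a (i : 'I_(size la)) := (nth 0%N la i + w i)%N.
have [/forallP le|] := boolP [forall i : 'I_(size la), (i <= a i)%N]; last first.
  rewrite negb_forall => /existsP[i /negbTE ni].
  rewrite (bigD1 i) //= mxE -/(a i) ni mul0r; exact: spn0.
pose mu := [seq (a i - i)%N | i <- enum 'I_(size la)].
rewrite (eq_bigr (fun i => h (a i - i))) => [|i _]; last by rewrite mxE le.
have -> : \prod_(i < size la) h (a i - i) = hl h mu :> Lam.
  by rewrite /hl big_map big_enum.
rewrite hl_partition_of; apply: spn_b.
have szmu : size mu = size la by rewrite size_map size_enum_ord.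
have pre k : (k <= size la)%N ->
    (sumn (take k mu) + \sum_(i < size la | i < k) i =
     sumn (take k la) + \sum_(i < size la | i < k) w i)%N.
  move=> lek; rewrite !sumn_take_nth.
  rewrite (big_ord_widen _ (fun i => nth 0 mu i)%N lek).
  rewrite (big_ord_widen _ (fun i => nth 0 la i)%N lek).
  rewrite -!big_split; apply: eq_bigr => i _ /=.
  rewrite (nth_map i) ?size_enum_ord // nth_ord_enum subnK //; exact: le.
apply: raises_dominates; split=> // [k|].
  have [lek|ltk] := leqP k (size la).
    by have := pre k lek; have := sum_perm_ge w lek; lia.
  have := pre _ (leqnn _); have := sum_perm_ge w (leqnn _).
  by rewrite !take_oversize ?szmu //; lia.
have := pre _ (leqnn _); rewrite addn0 -{1}szmu !take_size.
under eq_bigl do rewrite ltn_ord.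
under [in RHS]eq_bigl do rewrite ltn_ord.
by rewrite [in LHS](reindex_inj (@perm_inj _ w)) /= => /addIn.
Qed.

Lemma in_span_schur (mu : seq nat) f :
    in_span (fun la : intpart => s la) (fun la => dominates la mu) f ->
  spn hI (fun la => dominates la mu) f.
Proof.
move=> [c [supp ->]]; rewrite big_seq; apply: spn_sum => la lac.
apply/spnZ; apply: spnS (spn_schur la) => nu; move/dominates_trans; apply.
exact: supp.
Qed.

(** Inversion of a triangular matrix, from the top of the dominance order down. A zero diagonal
    entry would put b mu in the span of the strictly dominating b, against the second hypothesis. *)
Lemma spn_hI_triangular (b : intpart -> Lam) :
    (forall mu : intpart, spn hI (fun la => dominates la mu) (b mu)) ->
    (forall mu : intpart,
      ~ spn b (fun la => dominates la mu /\ la <> mu) (b mu)) ->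
  forall mu : intpart, spn b (fun la => dominates la mu) (hI mu).
Proof.
move=> bh indep; apply: dominates_ind => mu IH.
have IH' f : spn hI (fun la => dominates la mu /\ la <> mu) f ->
    spn b (fun la => dominates la mu /\ la <> mu) f.
  apply: spn_trans => la [dla ne]; apply: spnS (IH la dla ne) => nu dnu.
  split=> [|e]; first exact: dominates_trans dnu dla.
  by apply/ne/dominates_anti => //; rewrite -e.
have [a [g [be /IH' Hg]]] := spn_split mu (bh mu).
have [a0|a0] := eqVneq a 0.
  by case: (indep mu); rewrite be a0 scale0r add0r.
have -> : hI mu = a^-1 *: (b mu - g).
  by rewrite be addrK scalerA mulVf // scale1r.
apply/spnZ/spnB; first exact: spn_b.
by apply: spnS Hg => la [].
Qed.

End CompleteProducts.

Definition cpart (mu : intpart) : intpart := IntPart (conj_intpart mu).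

Lemma cpartK : involutive cpart.
Proof. by move=> mu; apply: val_inj; exact: conj_partK. Qed.

(** * Transfer of triangularity to the Macdonald basis *)

Section Eigenvectors.
Variables (K : fieldType) (H : intpart -> Lam K).
Hypothesis basis_H : is_basis H.
Local Notation Lam := (Lam K).
#[local] Opaque p h e scl psi.

(* [phi] is the substitution x -> x(1-q) (with c the identity) or x -> x(1-t)
   (with c the conjugation of partitions). *)
Section OneSide.
Variables (c : intpart -> intpart) (phi phiV : {linear Lam -> Lam}).
Hypothesis cK : involutive c.
Hypothesis phiK : cancel phi phiV.
Hypothesis phi_H : forall mu : intpart,
  spn (@hI K) (fun la => dominates la mu) (phi (H (c mu))).

Let spn_phiV P f : spn (fun mu => phi (H (c mu))) P f ->
  spn H (fun mu => P (c mu)) (phiV f).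
Proof.
apply: spn_map => mu Pmu; rewrite phiK; apply: spn_b.
by rewrite cK.
Qed.

Let hI_phi_H (mu : intpart) :
  spn (fun mu => phi (H (c mu))) (fun la => dominates la mu) (hI K mu).
Proof.
apply: spn_hI_triangular => // {}mu /spn_phiV; rewrite phiK => Hmu.
have : H (c mu) = 0; last by apply/eqP/basis_neq0.
apply: (spn_disjoint basis_H (Q := fun nu => nu = c mu)) Hmu _ => [nu|].
  by move=> [_ ne] e; apply: ne; rewrite e cK.
exact: spn_b.
Qed.

Lemma spn_preim (P : intpart -> Prop) f :
    (forall la mu : intpart, P mu -> dominates la mu -> P la) ->
  spn (@hI K) P (phi f) -> spn H (fun nu => P (c nu)) f.
Proof.
move=> upP Pf; rewrite -(phiK f); apply: (spn_phiV (P := P)).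
apply: spn_trans Pf => la Pla; apply: spnS (hI_phi_H la) => nu.
exact: upP.
Qed.

(** Up to strictly dominating terms, phi(H (c mu)) is a multiple of h_mu, and L' preserves the span
    of those terms; so [d mu] carries over. *)
Lemma triangular_on_H (L L' : {linear Lam -> Lam}) (d : intpart -> K) :
    (forall f, phi (L f) = L' (phi f)) ->
    (forall mu : intpart, spn (@hI K) (fun la => dominates la mu /\ la <> mu)
      (L' (hI K mu) - d mu *: hI K mu)) ->
  forall mu : intpart, spn H (fun nu => dominates (c nu) mu /\ c nu <> mu)
    (L (H (c mu)) - d mu *: H (c mu)).
Proof.
move=> conjL triL mu.
pose gt (la : intpart) := dominates la mu /\ la <> mu.
have up (nu la : intpart) : gt la -> dominates nu la -> gt nu.
  move=> [dla ne] dnu; split; first exact: dominates_trans dnu dla.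
  by move=> e; apply/ne/dominates_anti => //; rewrite -e.
have L'_gt (la : intpart) : gt la -> spn (@hI K) gt (L' (hI K la)).
  move=> gla; rewrite -[L' _](subrK (d la *: hI K la)); apply: spnD.
    by apply: spnS (triL la) => nu [/(up nu la gla)].
  exact/spnZ/spn_b.
apply: (spn_preim (P := gt)) => //.
rewrite linearB linearZ /= conjL.
have [a [w [-> Hw]]] := spn_split mu (phi_H mu).
rewrite linearP scalerDr scalerA /= [d mu * a]mulrC -scalerA opprD addrACA.
rewrite -scalerBr; apply: spnD; first exact/spnZ/triL.
by apply: spnB; [exact: spn_map Hw | exact: spnZ Hw].
Qed.

End OneSide.

End Eigenvectors.

(** * Evaluation at the cells of a partition *)

Section Cells.
Variable K : fieldType.
Implicit Types (mu : seq nat) (x y : K) (xs : seq K).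

(** M = (1 - x) + (xy - y), so h_j[M] is the convolution of two series of differences of letters,
    summed as a geometric progression. *)
Lemma newton_M x y : 1 - x * y != 0 ->
  newton (fun k => M (x ^+ k) (y ^+ k))
    (fun j => if j is 0%N then 1
              else M x y / (1 - x * y) * (1 - (x * y) ^+ j)).
Proof.
move=> nz.
apply: newton_ext (newton_conv (newton_Bgeom 1 x) (newton_Bgeom (x * y) y)).
  by move=> k _; rewrite /M expr1n exprMn; ring.
case=> [|n]; first by rewrite big_ord1 mulr1.
rewrite big_ord_recl (big_ord_recr n) /= subnn.
under eq_bigr => i _ do rewrite /bump /= add1n expr1n subSS.
have -> : \sum_(i < n) 1 * (1 - x) * match (n - i)%N with
    0%N => 1 | n'.+1 => (x * y) ^+ n' * (x * y - y) end =
    (1 - x) * (x * y - y) * \sum_(i < n) (x * y) ^+ i.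
  rewrite mulr_sumr (reindex_inj rev_ord_inj); apply: eq_bigr => i _ /=.
  by rewrite subKn //; ring.
have geo : (x * y) ^+ n = 1 - (1 - x * y) * \sum_(i < n) (x * y) ^+ i.
  by rewrite -[1 - x * y]opprB mulNr -subrX1; ring.
rewrite expr1n exprS geo /M; move: (\sum_(i < n) _) => S.
by field.
Qed.

Definition cells mu x y : seq K :=
  [seq y ^+ i * x ^+ j | i <- index_iota 0 (size mu),
                         j <- index_iota 0 (nth 0%N mu i)].

Lemma big_cells (R : Type) (idx : R) (op : Monoid.law idx) (F : K -> R) mu x y :
  \big[op/idx]_(z <- cells mu x y) F z =
  \big[op/idx]_(i < size mu) \big[op/idx]_(j < nth 0%N mu i) F (y ^+ i * x ^+ j).
Proof.
rewrite /cells big_allpairs_dep big_mkord.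
by apply: eq_bigr => i _; rewrite big_mkord.
Qed.

Lemma size_cells mu x y : size (cells mu x y) = sumn mu.
Proof.
have := sumn_take_nth mu (size mu); rewrite take_size => ->.
rewrite -sum1_size big_cells.
by apply: eq_bigr => i _; rewrite sum1_card card_ord.
Qed.

Lemma B_cells mu x y k : B mu (x ^+ k) (y ^+ k) = \sum_(z <- cells mu x y) z ^+ k.
Proof.
rewrite big_cells; apply: eq_bigr => i _; apply: eq_bigr => j _.
by rewrite exprMn -!exprM ![(k * _)%N]mulnC.
Qed.

Lemma B_cellsV mu x y : B mu x^-1 y^-1 = \sum_(z <- cells mu x y) z^-1.
Proof.
rewrite big_cells; apply: eq_bigr => i _; apply: eq_bigr => j _.
by rewrite invfM !exprVn.
Qed.

Lemma T_cells mu x y : sorted geq mu -> T x y mu = \prod_(z <- cells mu x y) z.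
Proof.
move=> srt; rewrite big_cells /T nstat_conj // /nstat.
rewrite (big_nth 0%N) big_mkord.
transitivity (\prod_(i < size mu)
    (y ^+ (i * nth 0 mu i) * x ^+ (\sum_(j < nth 0%N mu i) j))).
  by rewrite big_split /= -!expr_sum.
apply: eq_bigr => i _; rewrite big_split /= prodr_const card_ord -expr_sum.
by rewrite -exprM.
Qed.

(** Its k-th coefficient is (-1)^k e_k(xs). *)
Definition cell_poly xs : {poly K} := \prod_(x <- xs) (1 - x *: 'X).

Lemma coef_cell_poly_cons x xs k :
  (cell_poly (x :: xs))`_k.+1 = (cell_poly xs)`_k.+1 - x * (cell_poly xs)`_k.
Proof. by rewrite /cell_poly big_cons mulrBl mul1r coefB -scalerAl coefZ coefXM. Qed.

Lemma coef0_cell_poly xs : (cell_poly xs)`_0 = 1.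
Proof.
elim: xs => [|x xs IH]; first by rewrite /cell_poly big_nil coef1.
rewrite /cell_poly big_cons mulrBl mul1r coefB -scalerAl coefZ coefXM mulr0 subr0.
exact: IH.
Qed.

Lemma newton_cell_poly xs :
  newton (fun k => - \sum_(x <- xs) x ^+ k) (fun j => (cell_poly xs)`_j).
Proof.
elim: xs => [|x xs IH].
  split=> [|n]; first exact: coef0_cell_poly.
  rewrite /cell_poly big_nil coef1 mulr0 big1 // => i _.
  by rewrite big_nil oppr0 mul0r.
apply: newton_ext (newton_conv (newton_neg_geom x) IH).
  by move=> k _; rewrite big_cons opprD.
case=> [|n]; first by rewrite big_ord1 !coef0_cell_poly mul1r.
rewrite coef_cell_poly_cons !big_ord_recl big1 ?addr0 => [|i _].
  by rewrite mul1r mulNr /= /bump /= subn0 subn1.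
by rewrite mul0r.
Qed.

Lemma cell_poly_top xs :
  (cell_poly xs)`_(size xs) = (-1) ^+ size xs * \prod_(x <- xs) x /\
  forall k, (size xs < k)%N -> (cell_poly xs)`_k = 0.
Proof.
elim: xs => [|x xs [IH1 IH2]].
  rewrite /cell_poly !big_nil coef1 mulr1; split=> // k.
  by rewrite coef1; case: k.
split=> [|[//|k] le].
  by rewrite coef_cell_poly_cons IH1 IH2 // big_cons exprS; ring.
by rewrite coef_cell_poly_cons !IH2 ?mulr0 ?subrr // ltnW.
Qed.

(** Omitting one letter at a time, e_(n-1) of n nonzero letters is their product times the sum of
    their inverses; this is how 1/q and 1/t enter. *)
Lemma cell_poly_subtop x xs : all (predC1 0) (x :: xs) ->
  (cell_poly (x :: xs))`_(size xs) =
  (-1) ^+ size xs * \prod_(y <- x :: xs) y * \sum_(y <- x :: xs) y^-1.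
Proof.
elim: xs x => [|y xs IH] x /= /andP[x0 nz].
  by rewrite coef0_cell_poly !big_seq1 mul1r mulfV.
rewrite coef_cell_poly_cons IH //.
have [/= -> _] := cell_poly_top (y :: xs).
rewrite (big_cons _ _ x) [\sum_(z <- [:: x, y & _]) _]big_cons exprS.
move: (\prod_(_ <- _) _) (\sum_(_ <- _) _) => a b.
by field.
Qed.

End Cells.

(** * Eigenvalues of the Delta operators *)

Section Delta.
Variable K : fieldType.
Hypothesis pcharK0 : [pchar K] =i pred0.
Variables (q t : K).
#[local] Opaque p h e scl psi.

Lemma plethB_e k mu : plethB q t (e k) mu = (-1) ^+ k * (cell_poly (cells mu q t))`_k.
Proof.
pose f := pleth idfun (fun k => B mu (q ^+ k) (t ^+ k)) : Lam K -> K.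
have fp i : (0 < i)%N -> f (- p i) = - \sum_(z <- cells mu q t) z ^+ i.
  move=> i0; rewrite -B_cells.
  by rewrite -(pleth_p idfun (fun k => B mu (q ^+ k) (t ^+ k)) i0) -rmorphN.
have nf := eq_newton fp (newton_morph
  (pleth idfun (fun k => B mu (q ^+ k) (t ^+ k))) (newton_e pcharK0)).
rewrite -(newton_uniq (natr_lreg pcharK0) nf (newton_cell_poly _) k).
by rewrite /= rmorphM rmorph_sign mulrA -expr2 sqrr_sign mul1r.
Qed.

Lemma plethB_e1 mu : plethB q t (e 1) mu = B mu q t.
Proof.
rewrite plethB_e -[q in RHS]expr1 -[t in RHS]expr1 B_cells expr1.
elim: (cells mu q t) => [|x xs IH].
  by rewrite /cell_poly !big_nil coef1 mulr0.
rewrite coef_cell_poly_cons coef0_cell_poly big_cons mulrBr IH expr1; ring.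
Qed.

Lemma plethB_e_pred mu n : q != 0 -> t != 0 -> sorted geq mu -> sumn mu = n.+1 ->
  plethB q t (e n) mu = T q t mu * B mu q^-1 t^-1.
Proof.
move=> q0 t0 srt smu; rewrite plethB_e T_cells // B_cellsV.
have : all (predC1 0) (cells mu q t).
  apply/allP => z /allpairsPdep[i [j [_ _ ->]]] /=.
  by rewrite mulf_neq0 ?expf_neq0.
have := size_cells mu q t; rewrite smu; case: (cells mu q t) => // x xs [<-] nz.
by rewrite cell_poly_subtop // !mulrA -expr2 sqrr_sign mul1r.
Qed.

End Delta.

(** * The operators D_0 and D_0' *)

HB.instance Definition _ (K : fieldType) (q t : K) :=
  GRing.Linear.copy (opE q t) (opD (fun k => 1 - t ^+ k)
    (fun j => scl (fun k => q ^+ k - 1) (h j)) 0).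

(* The Macdonald operator D_0 and, with both parameters inverted and x replaced
   by -x, its companion D_0'. *)
Definition D0 (K : fieldType) (q t : K) : Lam K -> Lam K :=
  opD (fun k => M (q ^+ k) (t ^+ k)) (fun j => scl (fun=> -1) (h j)) 0.
HB.instance Definition _ (K : fieldType) (q t : K) :=
  GRing.Linear.copy (D0 q t)
    (opD (fun k => M (q ^+ k) (t ^+ k)) (fun j => scl (fun=> -1) (h j)) 0).

Definition D0s (K : fieldType) (q t : K) : Lam K -> Lam K :=
  scl (fun=> -1) \o D0 q^-1 t^-1 \o scl (fun=> -1).
HB.instance Definition _ (K : fieldType) (q t : K) :=
  GRing.Linear.copy (D0s q t)
    (scl (fun=> -1) \o D0 q^-1 t^-1 \o scl (fun=> -1)).

Lemma prod_geom_scale (K : fieldType) (A : comAlgType K) (c : K) (F : nat -> A) l :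
  \prod_(a <- l) (c ^+ a *: F a) = c ^+ sumn l *: \prod_(a <- l) F a.
Proof.
elim: l => [|a l IH]; first by rewrite !big_nil scale1r.
by rewrite !big_cons IH -scalerAl -scalerAr scalerA exprD.
Qed.

Section Conjugation.
Variable K : fieldType.
Local Notation Lam := (Lam K).
#[local] Opaque p h e scl psi.
Implicit Types (q t c : K) (f : Lam).

Lemma D0C q t f : D0 q t f = D0 t q f.
Proof.
apply: eq_opD => [k _|j]; last by [].
by rewrite /M mulrC.
Qed.

Lemma D0sC q t f : D0s q t f = D0s t q f.
Proof. by rewrite /D0s /= D0C. Qed.

Lemma scl_D0 q t f :
  scl (fun k => 1 - q ^+ k) (D0 q t f) = opE q t (scl (fun k => 1 - q ^+ k) f).
Proof.
rewrite (scl_opD (v' := fun k => 1 - t ^+ k)); last first.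
  by move=> k _; rewrite /M mulrC.
apply: eq_opD => [k _|j]; first by [].
by apply: scl_comp => k _; rewrite mulrN1 opprB.
Qed.

(** After x -> -x, the factor 1-q becomes q-1 = q(1 - 1/q): this explains the rescaling by q around
    E(1/q,1/t). *)
Lemma scl_D0s q t f : q != 0 ->
  scl (fun k => 1 - q ^+ k) (D0s q t f) =
  scl (fun k => q ^+ k) (opE q^-1 t^-1 (scl (fun k => q^-1 ^+ k)
    (scl (fun k => 1 - q ^+ k) f))).
Proof.
move=> q0; have qV k : q ^+ k * q^-1 ^+ k = 1 by rewrite -exprMn mulfV ?expr1n.
have -> : scl (fun k => q^-1 ^+ k) (scl (fun k => 1 - q ^+ k) f) =
    scl (fun k => 1 - q^-1 ^+ k) (scl (fun=> -1) f).
  rewrite !(scl_comp (w := fun k => q^-1 ^+ k - 1)) // => k _.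
    by rewrite mulrN1 opprB.
  by rewrite mulrBr mulr1 mulrC qV.
rewrite -scl_D0 /D0s /= !(scl_comp (w := fun k => q ^+ k - 1)) // => k _.
  by rewrite mulrBr mulr1 qV.
by rewrite mulrN1 opprB.
Qed.

End Conjugation.

Section Spectrum.
Variable K : fieldType.
Hypothesis pcharK0 : [pchar K] =i pred0.
Local Notation Lam := (Lam K).
#[local] Opaque p h e scl psi.
Implicit Types (q t c : K).

Lemma eigenvalueE q t (mu : seq nat) :
  t ^+ size mu + (1 - t) * mac_eig q t mu = 1 - M q t * B mu q t.
Proof.
have geo (x : K) n : (1 - x) * (\sum_(i < n) x ^+ i) = 1 - x ^+ n.
  by rewrite -opprB mulNr -subrX1 opprB.
have -> : M q t * B mu q t =
    (1 - t) * \sum_(i < size mu) (t ^+ i - t ^+ i * q ^+ nth 0%N mu i).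
  rewrite /M -mulrA; congr (_ * _); rewrite /B mulr_sumr; apply: eq_bigr => i _.
  by rewrite -mulr_sumr mulrCA geo mulrBr mulr1.
rewrite sumrB mulrBr geo /mac_eig; ring.
Qed.

Lemma scl_geom_hI c (la : intpart) :
  scl (fun k => c ^+ k) (hI K la) = c ^+ sumn la *: hI K la.
Proof.
rewrite /hI /hl rmorph_prod -prod_geom_scale; apply: eq_bigr => a _.
exact: scl_geom_h.
Qed.

(** Rescaling x only multiplies each h_la by a scalar, and c c' = 1 restores the diagonal entry. *)
Lemma opE_scaled_triangular (q t c c' : K) (la : intpart) : c * c' = 1 ->
  spn (@hI K) (fun mu => dominates mu la /\ mu <> la)
    (scl (fun k => c ^+ k) (opE q t (scl (fun k => c' ^+ k) (hI K la)))
     - (1 - M q t * B la q t) *: hI K la).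
Proof.
move=> cc; set d := 1 - _; set f := hI K la.
have -> : scl (fun k => c ^+ k) (opE q t (scl (fun k => c' ^+ k) f)) - d *: f =
    c' ^+ sumn la *: scl (fun k => c ^+ k) (opE q t f - d *: f).
  rewrite (raddfB (scl _)) /= sclZ [in RHS]/f scl_geom_hI -/f scalerBr.
  have -> : c' ^+ sumn la *: (d *: (c ^+ sumn la *: f)) = d *: f.
    by rewrite !scalerA mulrAC -exprMn [c' * c]mulrC cc expr1n mul1r.
  by rewrite scl_geom_hI linearZ /= sclZ.
apply: spnZ.
have := opE_triangular pcharK0 q t la; rewrite eigenvalueE -/d -/f.
apply: spn_map => mu mula.
by rewrite /= scl_geom_hI; apply/spnZ/spn_b.
Qed.

End Spectrum.

Lemma conv_last (A : pzRingType) (F G : nat -> A) n a : F 0%N = 1 ->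
  \sum_(i < n.+1) F (n - i)%N * G i = a ->
  G n = a - \sum_(i < n) F (n - i)%N * G i.
Proof. by move=> F0 <-; rewrite big_ord_recr /= subnn F0 mul1r addrC addrK. Qed.

(** * Macdonald polynomials diagonalize D_0 and D_0' *)

Section MacdonaldOperators.
Variable K : fieldType.
Hypothesis pcharK0 : [pchar K] =i pred0.
Local Notation Lam := (Lam K).
#[local] Opaque p h e scl psi.
Variables (q t : K) (H : intpart -> Lam).
Hypothesis HH : is_modified_macdonald q t H.
Hypothesis q_order : forall k, (0 < k)%N -> 1 - q ^+ k != 0.
Hypothesis t_order : forall k, (0 < k)%N -> 1 - t ^+ k != 0.
Hypotheses (q0 : q != 0) (t0 : t != 0).

Let basis_H : is_basis H := macdonald_basis HH.

Local Notation phi x := (scl (fun k => 1 - x ^+ k)).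
Local Notation phiV x := (scl (fun k => (1 - x ^+ k)^-1)).

Let phiK (x : K) : (forall k, (0 < k)%N -> 1 - x ^+ k != 0) -> cancel (phi x) (phiV x).
Proof.
move=> nz f; rewrite (scl_comp (w := fun=> 1)).
  by apply: scl_id => k _.
by move=> k k0; rewrite mulVf ?nz.
Qed.

Let phi_q (mu : intpart) :
  spn (@hI K) (fun la => dominates la mu) (phi q (H mu)).
Proof. exact: in_span_schur (macdonald_q HH mu). Qed.

Let phi_t (mu : intpart) :
  spn (@hI K) (fun la => dominates la mu) (phi t (H (cpart mu))).
Proof.
have := in_span_schur (macdonald_t HH (cpart mu)).
by have -> : conj_part (cpart mu) = mu by exact: conj_partK.
Qed.

(** The first triangularity puts L H_mu - d1 H_mu in the span of H_nu with nu strictly above mu, the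
    second in the span of those with nu' above or equal to mu'. By [dominates_conj_anti] no index is
    common, so the difference vanishes. *)
Let eigen_of_triangular (L L1 L2 : {linear Lam -> Lam}) (d1 d2 : intpart -> K) :
    (forall f, phi q (L f) = L1 (phi q f)) ->
    (forall f, phi t (L f) = L2 (phi t f)) ->
    (forall mu : intpart, spn (@hI K) (fun la => dominates la mu /\ la <> mu)
      (L1 (hI K mu) - d1 mu *: hI K mu)) ->
    (forall mu : intpart, spn (@hI K) (fun la => dominates la mu /\ la <> mu)
      (L2 (hI K mu) - d2 mu *: hI K mu)) ->
  forall mu, L (H mu) = d1 mu *: H mu.
Proof.
move=> c1 c2 T1 T2 mu.
have S1 := triangular_on_H (c := id) basis_H (fun=> erefl) (phiK q_order)
  phi_q c1 T1 mu.
have := triangular_on_H basis_H cpartK (phiK t_order) phi_t c2 T2 (cpart mu).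
rewrite cpartK => S2; apply/eqP; rewrite -subr_eq0; apply/eqP.
pose Q nu := dominates (conj_part nu) (conj_part mu).
apply: (spn_disjoint basis_H (Q := Q)) S1 _.
  by move=> nu [dnu ne] Qnu; apply/ne/dominates_conj_anti.
have spn_mu : spn H Q (H mu) by apply: spn_b.
apply: spnB; last exact: spnZ spn_mu.
rewrite -[L _](subrK (d2 (cpart mu) *: H mu)); apply: spnD; last exact: spnZ spn_mu.
by apply: spnS S2 => nu [].
Qed.

Lemma D0_eigen mu : D0 q t (H mu) = (1 - M q t * B mu q t) *: H mu.
Proof.
apply: (eigen_of_triangular (L := D0 q t) (L1 := opE q t) (L2 := opE t q)
  (d1 := fun mu => 1 - M q t * B mu q t)
  (d2 := fun mu => 1 - M t q * B mu t q)) => [f|f|la|la].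
- exact: scl_D0.
- by have := scl_D0 t q f; rewrite D0C.
- by rewrite -eigenvalueE; exact: opE_triangular.
- by rewrite -eigenvalueE; exact: opE_triangular.
Qed.

Lemma D0s_eigen mu :
  D0s q t (H mu) = (1 - M q^-1 t^-1 * B mu q^-1 t^-1) *: H mu.
Proof.
apply: (eigen_of_triangular (L := D0s q t)
  (L1 := scl (fun k => q ^+ k) \o opE q^-1 t^-1 \o scl (fun k => q^-1 ^+ k))
  (L2 := scl (fun k => t ^+ k) \o opE t^-1 q^-1 \o scl (fun k => t^-1 ^+ k))
  (d1 := fun mu => 1 - M q^-1 t^-1 * B mu q^-1 t^-1)
  (d2 := fun mu => 1 - M t^-1 q^-1 * B mu t^-1 q^-1)) => [f|f|la|la].
- exact: scl_D0s.
- by have := scl_D0s q f t0; rewrite D0sC.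
- by apply: opE_scaled_triangular => //; rewrite mulfV.
- by apply: opE_scaled_triangular => //; rewrite mulfV.
Qed.

(** Only the empty partition dominates the empty partition, so its polynomial is constant after x ->
    x(1-q), hence before; a basis element is nonzero. *)
Lemma H_empty : exists2 c, c != 0 & H (IntPart (isT : is_intpart [::])) = c%:A.
Proof.
set mu := IntPart _; have := phi_q mu.
have nat_c f : spn (@hI K) (fun la => dominates la mu) f -> exists c, f = c%:A.
  elim=> [|c la g [sla _] _ [d ->]]; first by exists 0; rewrite scale0r.
  exists (c + d); have -> : la = mu.
    apply: val_inj => /=; move: sla; have := intpart_pos la.
    by case: (parts la) => //= a l; rewrite inE negb_or => /andP[]; case: a.
  by rewrite /hI /hl big_nil scalerDl.
move=> /nat_c[c phiHc]; have HE : H mu = c%:A.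
  by rewrite -(phiK q_order (H mu)) phiHc sclA.
exists c => //; apply/eqP => c0; have /eqP := basis_neq0 basis_H mu.
by rewrite HE c0 scale0r.
Qed.

(** The convolution [sum_h_geomB], solved for its last term, gives h_n[(c-1)x] recursively in
    products of total degree n. *)
Lemma scl_h_spn (c : K) n :
  spn (hl (h : nat -> Lam)) (fun l => sumn l = n) (scl (fun k => c ^+ k - 1) (h n)).
Proof.
elim/ltn_ind: n => n IH.
have spn_h a m f : spn (hl (h : nat -> Lam)) (fun l => sumn l = m) f ->
    spn (hl (h : nat -> Lam)) (fun l => sumn l = (a + m)%N) (h a * f).
  elim=> [|d l g <- _ IHg]; first by rewrite mulr0; exact: spn0.
  rewrite mulrDr -scalerAr; apply: spnD IHg; apply: spnZ.
  by rewrite -hl_cons; exact: spn_b.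
have hn : spn (hl (h : nat -> Lam)) (fun l => sumn l = n) (h n).
  by rewrite -hl1; apply: spn_b; exact: addn0.
rewrite (conv_last (G := fun i => scl _ (h i)) (h0 K) (sum_h_geomB pcharK0 c n)).
apply: spnB; first exact: spnZ hn.
apply: spn_sum => i _; have := spn_h (n - i)%N i _ (IH i (ltn_ord i)).
by rewrite subnK ?(ltnW (ltn_ord i)).
Qed.

End MacdonaldOperators.

Lemma signK (K : fieldType) (A : comAlgType K) n (x : A) :
  (-1) ^+ n *: ((-1) ^+ n * x) = x.
Proof. by rewrite scalE rmorph_sign mulrA -expr2 sqrr_sign mul1r. Qed.

(** * Action of D_0 on h_n and of D_0' on e_n *)

Section CompleteAndElementary.
Variable K : fieldType.
Hypothesis pcharK0 : [pchar K] =i pred0.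
Local Notation Lam := (Lam K).
#[local] Opaque p h e scl psi.

Lemma sum_contract (A : comAlgType K) (a z : K) (c : nat -> K) (F G : nat -> A) n :
    (forall j, c j = if j is 0%N then 1 else a * (1 - z ^+ j)) -> G 0%N = 1 ->
  \sum_(j < n.+1) c j *: (F (n - j)%N * G j) =
  F n + a *: (\sum_(j < n.+1) G j * F (n - j)%N
              - \sum_(j < n.+1) (z ^+ j *: G j) * F (n - j)%N).
Proof.
move=> cE G0; rewrite -sumrB scaler_sumr !big_ord_recl.
rewrite cE G0 subn0 expr0 !scale1r !mul1r mulr1 subrr scaler0 add0r; congr (_ + _).
by apply: eq_bigr => j _; rewrite cE /= !scalE; ring.
Qed.

(** D_0 h_n is the sum of h_j[M] h_(n-j) h_j[-x]. As h_j[M] is proportional to 1 - (qt)^j for j > 0,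
    it involves only h_n[x - x] = 0 and h_n[x - qtx], besides h_n. *)
Lemma D0_h (q t : K) n : 1 - q * t != 0 -> (0 < n)%N ->
  h n - D0 q t (h n) =
  (M q t / (1 - q * t)) *: scl (fun k => 1 - (q * t) ^+ k) (h n).
Proof.
move=> nz n0; pose z := q * t; pose a := M q t / (1 - q * t).
pose G j : Lam := scl (fun=> -1) (h j).
have G0 : G 0%N = 1 by rewrite /G (h0 K) rmorph1.
have DE : D0 q t (h n) = h n
    + a *: (\sum_(j < n.+1) G j * h (n - j)
              - \sum_(j < n.+1) (z ^+ j *: G j) * h (n - j)).
  rewrite -(sum_contract (c := fun j =>
    if j is 0%N then 1 else a * (1 - z ^+ j)) h n (fun j => erefl) G0).
  rewrite -[h n in LHS]mulr1 /D0 (opD_h pcharK0 _ _ _ _ (newton_M nz)).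
  by apply: eq_bigr => j _; rewrite opD1.
have S1 : \sum_(j < n.+1) G j * h (n - j) = 0.
  (* Zero is written as 0^k so that [scl_geom_h] yields the factor 0^n, which vanishes for n > 0. *)
  have w0 k : (0 < k)%N -> -1 + 1 = 0 ^+ k :> K.
    by move=> k0; rewrite addNr expr0n gtn_eqF.
  have := scl_conv pcharK0 (u := fun=> -1) (v := fun=> 1) n w0.
  rewrite (scl_geom_h pcharK0) expr0n gtn_eqF // scale0r; apply: etrans.
  by apply: eq_bigr => j _; rewrite [scl (fun=> 1) _]scl_id.
have S2 : \sum_(j < n.+1) (z ^+ j *: G j) * h (n - j) =
    scl (fun k => 1 - z ^+ k) (h n).
  rewrite -(scl_conv pcharK0 (u := fun k => - z ^+ k) (v := fun=> 1)).
    apply: eq_bigr => j _; rewrite [scl (fun=> 1) _]scl_id; last by [].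
    rewrite /G -(sclZ (fun=> -1)) -(scl_geom_h pcharK0).
    by rewrite (scl_comp (w := fun k => - z ^+ k)) // => k _; rewrite mulN1r.
  by move=> k _; rewrite addrC.
have cancel_h (V : lmodType K) (x y : V) : x - (x + a *: (0 - y)) = a *: y.
  by rewrite sub0r scalerN opprB addrC subrK.
have {S1 S2}DE := etrans DE (congr2 (fun u v => h n + a *: (u - v)) S1 S2).
rewrite DE; exact: cancel_h.
Qed.

#[local] Opaque D0.

Lemma e_scl n : e n = (-1) ^+ n *: scl (fun=> -1) (h n) :> Lam.
Proof.
by rewrite (sclN1_h pcharK0) signK.
Qed.

(** Since e_n = (-1)^n h_n[-x], one reflection cancels and [D0_h] applies at 1/q, 1/t. The other
    turns 1 - 1/(qt) into (1 - qt)/(qt). *)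
Lemma D0s_e (q t : K) n : q * t != 0 -> 1 - q * t != 0 -> (0 < n)%N ->
  e n - D0s q t (e n) =
  ((-1) ^+ n * (M q^-1 t^-1 / (1 - (q * t)^-1)) * (q * t)^-1 ^+ n) *:
    scl (fun k => 1 - (q * t) ^+ k) (h n).
Proof.
move=> qt0 nz n0; have nz' : 1 - q^-1 * t^-1 != 0.
  rewrite -invfM; apply: contraNneq nz => /eqP; rewrite subr_eq0 => /eqP e1.
  by rewrite -[q * t]invrK -e1 invr1 subrr.
have sclNK f : scl (fun=> -1) (scl (fun=> -1) f) = f :> Lam.
  rewrite (scl_comp (w := fun=> 1)); first by rewrite scl_id.
  by move=> k _; rewrite mulrNN mulr1.
have D0sE (c : K) f :
    D0s q t (c *: scl (fun=> -1) f) = c *: scl (fun=> -1) (D0 q^-1 t^-1 f).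
  have DsZ f' : D0s q t (c *: f') = c *: D0s q t f' by exact: linearZ.
  have DsE f' : D0s q t f' = scl (fun=> -1) (D0 q^-1 t^-1 (scl (fun=> -1) f')).
    by [].
  by rewrite DsZ DsE sclNK.
have key : scl (fun=> -1) (scl (fun k => 1 - (q * t)^-1 ^+ k) (h n)) =
    (q * t)^-1 ^+ n *: scl (fun k => 1 - (q * t) ^+ k) (h n) :> Lam.
  rewrite -sclZ -(scl_geom_h pcharK0).
  rewrite (scl_comp (w := fun k => (q * t)^-1 ^+ k - 1)) => [|k _].
    rewrite (scl_comp (w := fun k => (q * t)^-1 ^+ k - 1)) // => k _.
    by rewrite mulrBl mul1r -exprMn mulfV // expr1n.
  by rewrite mulN1r opprB.
have sclB f g : scl (fun=> -1) (f - g) = scl (fun=> -1) f - scl (fun=> -1) g :> Lam.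
  exact: raddfB.
transitivity ((-1) ^+ n *: scl (fun=> -1) (h n - D0 q^-1 t^-1 (h n)) : Lam).
  rewrite sclB scalerBr.
  have subL (V : lmodType K) (L : V -> V) c (u v w : V) :
      u = c *: v -> L (c *: v) = c *: w -> u - L u = c *: v - c *: w.
    by move=> -> ->.
  by apply: subL; [exact: e_scl | exact: D0sE].
rewrite (D0_h nz' n0) sclZ -invfM key.
by rewrite [LHS]scalerA [LHS]scalerA; congr (_ *: _).
Qed.

End CompleteAndElementary.

(** * The identities *)

(** Applied with N the identity and L2 = D_0 for Delta_(e_1), and with N = nabla and L2 = nabla D_0'
    for Delta_(e_(n-1)). *)
Lemma spn_linear_rel (K : fieldType) (V : lmodType K) (I : Type) (b : I -> V)
    (P : I -> Prop) (L1 L2 N : {linear V -> V}) (a : K) v :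
    (forall i, P i -> a *: L1 (b i) = N (b i) - L2 (b i)) ->
  spn b P v -> a *: L1 v = N v - L2 v.
Proof.
move=> rel; elim=> [|c i w Pi _ IH].
  by rewrite (linear0 L1) (linear0 L2) (linear0 N) subr0 scaler0.
rewrite (linearP L1) (linearP L2) (linearP N) scalerDr scalerA mulrC -scalerA.
by rewrite rel // IH scalerBr opprD addrACA.
Qed.

Lemma scaler_congr (K : fieldType) (V : lmodType K) (a b : K) (v : V) :
  a = b -> a *: v = b *: v.
Proof. by move=> ->. Qed.

Section Identities.
Variable K : fieldType.
Hypothesis pcharK0 : [pchar K] =i pred0.
Local Notation Lam := (Lam K).
#[local] Opaque p h e scl.
Variables (q t : K) (H : intpart -> Lam).
Hypothesis HH : is_modified_macdonald q t H.
Hypothesis q_order : forall k, (0 < k)%N -> 1 - q ^+ k != 0.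
Hypothesis t_order : forall k, (0 < k)%N -> 1 - t ^+ k != 0.
Hypotheses (q0 : q != 0) (t0 : t != 0) (qt1 : 1 - q * t != 0).

(** After x -> x(1-q), e_n is a combination of h_la with |la| = n, and the way back to H preserves
    size. The formula for e_(n-1)[B_nu] is applied in this degree. *)
Lemma e_spn n : spn H (fun nu : intpart => sumn nu = n) (e n).
Proof.
have phiK : cancel (scl (fun k => 1 - q ^+ k) : Lam -> Lam)
    (scl (fun k => (1 - q ^+ k)^-1)).
  move=> f; rewrite (scl_comp (w := fun=> 1)); first exact: scl_id.
  by move=> k k0; rewrite mulVf // q_order.
apply: (spn_preim (c := id) (phi := scl (fun k => 1 - q ^+ k)) (macdonald_basis HH)
  (fun=> erefl) phiK (fun mu => in_span_schur (macdonald_q HH mu))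
  (P := fun nu : intpart => sumn nu = n)).
  by move=> la mu <- [].
rewrite /= (e_scl pcharK0) sclZ; apply: spnZ.
rewrite (scl_comp (w := fun k => q ^+ k - 1)); last first.
  by move=> k _; rewrite mulrN1 opprB.
apply: spn_trans (scl_h_spn pcharK0 q n) => l sl.
by rewrite hl_partition_of; apply: spn_b; rewrite /= sumn_partition_of.
Qed.

(** A constant is unaffected by the shift M/z, so only j = 0 contributes. *)
Lemma D_const (n : nat) c : D q t n (c%:A : Lam) = c *: ((-1) ^+ n * e n).
Proof.
have psi_c : pleth_xMz q t (c%:A : Lam) = c%:A%:P.
  exact: (psiA (fun k => M (q ^+ k) (t ^+ k))).
rewrite /D psi_c; have [->|c0] := eqVneq c 0.
  by rewrite !scale0r polyC0 size_poly0 big_ord0.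
have cA0 : c%:A != 0 :> Lam by rewrite scaler_eq0 negb_or c0 oner_eq0.
rewrite size_polyC cA0 big_ord1 coefC eqxx addn0.
exact: mulr_algl.
Qed.

Variables (nabla : {linear Lam -> Lam}) (nablaV : Lam -> Lam).
Hypothesis nablaE : diagonal_on H (fun mu => T q t mu) nabla.
Hypothesis nablaK : cancel nabla nablaV.

(** The eigenvalue at the empty partition is 1, so nabla fixes constants. *)
Lemma nablaV_const c : nablaV c%:A = c%:A.
Proof.
have [d d0 HE] := H_empty HH q_order.
have := nablaE (IntPart (isT : is_intpart [::])).
have -> : T q t (IntPart (isT : is_intpart [::])) = 1.
  by rewrite /T /nstat /= !big_ord0 mulr1.
rewrite scale1r HE => fix_d.
have fix_scal (V : lmodType K) (L : {linear V -> V}) (v : V) :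
    L (d *: v) = d *: v -> L (c *: v) = c *: v.
  move=> dv; have -> : c *: v = (c / d) *: (d *: v) by rewrite scalerA divfK.
  by rewrite linearZ /= dv.
have fix_c : nabla c%:A = c%:A by exact: fix_scal fix_d.
by have := nablaK c%:A; rewrite fix_c.
Qed.

Variable Delta : Lam -> {linear Lam -> Lam}.
Hypothesis DeltaE : forall f, diagonal_on H (fun mu => plethB q t f mu) (Delta f).

Let M0 : M q t != 0.
Proof. by rewrite mulf_neq0 // -[X in 1 - X]expr1 ?t_order ?q_order. Qed.

Let MV0 : M q^-1 t^-1 != 0.
Proof.
have V0 x : x != 0 -> 1 - x ^+ 1 != 0 -> 1 - x^-1 != 0 :> K.
  move=> x0; apply: contraNneq => /eqP; rewrite subr_eq0 => /eqP e1.
  by rewrite -[x]invrK -e1 invr1 expr1 subrr.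
by rewrite mulf_neq0 ?V0 ?t_order ?q_order.
Qed.

Let z := q * t.
Let X n : Lam := scl (fun k => 1 - z ^+ k) (h n).

Lemma Delta_e1_h n : (0 < n)%N -> Delta (e 1) (h n) = (1 - z)^-1 *: X n.
Proof.
move=> n0; apply: (scalerI M0).
rewrite (spn_linear_rel (b := H) (P := fun=> True) (N := idfun) (L2 := D0 q t)).
- rewrite [LHS](D0_h pcharK0 qt1 n0) [RHS]scalerA; exact: scaler_congr.
- move=> mu _; rewrite DeltaE (plethB_e1 pcharK0).
  have sub_eigen (V : lmodType K) (a b : K) (x y : V) :
      y = (1 - a * b) *: x -> a *: (b *: x) = x - y.
    by move=> ->; rewrite scalerA scalerBl scale1r subKr.
  exact: sub_eigen (D0_eigen pcharK0 HH q_order t_order mu).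
- exact: spn_full (macdonald_basis HH) _.
Qed.

(** In degree n, M(1/q,1/t) Delta_(e_(n-1)) = nabla (1 - D_0') by comparing eigenvalues; [D0s_e]
    then evaluates it. *)
Lemma Delta_e_pred_e n : (0 < n)%N -> Delta (e n.-1) (e n) =
  ((-1) ^+ n * (1 - z^-1)^-1 * z^-1 ^+ n) *: nabla (X n).
Proof.
move=> n0; apply: (scalerI MV0).
rewrite (spn_linear_rel (b := H) (P := fun nu : intpart => sumn nu = n)
  (N := nabla) (L2 := nabla \o D0s q t)).
- have sub_im (V : lmodType K) (L : {linear V -> V}) (c : K) (x y w : V) :
      x - y = c *: w -> L x - L y = c *: L w.
    by rewrite -linearB => ->; rewrite linearZ.
  apply: etrans (sub_im _ nabla _ _ _ _ (D0s_e pcharK0 (mulf_neq0 q0 t0) qt1 n0)) _.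
  by rewrite [RHS]scalerA; apply: scaler_congr; ring.
- move=> mu smu; have smu' : sumn mu = n.-1.+1 by rewrite smu prednK.
  rewrite DeltaE (plethB_e_pred pcharK0 q0 t0 (intpart_sorted mu) smu').
  have sub_eigen (V : lmodType K) (L : {linear V -> V}) (a b c : K) (x y : V) :
      L x = c *: x -> y = (1 - a * b) *: x -> a *: ((c * b) *: x) = L x - L y.
    move=> Lx ->; rewrite [L (_ *: _)]linearZ /= Lx !scalerA -scalerBl.
    by apply: scaler_congr; ring.
  exact: sub_eigen (nablaE mu) (D0s_eigen pcharK0 HH q_order t_order q0 t0 mu).
- exact: e_spn.
Qed.

Lemma scl_ratio_h n :
  plethx (fun k => ((1 - z ^+ k) / z ^+ k) *: p k) (h n) = z^-1 ^+ n *: X n.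
Proof.
rewrite /X -sclZ -(scl_geom_h pcharK0) (scl_comp (w := fun k => (1 - z ^+ k) / z ^+ k)) //.
by move=> k _; rewrite exprVn.
Qed.

Lemma Q_succ_e n : Q_succ q t nabla nablaV n ((-1) ^+ n) = nabla (e n).
Proof.
have sgn : (-1) ^+ n = ((-1) ^+ n)%:A :> Lam.
  by rewrite -[RHS]/(in_alg Lam _) rmorph_sign.
rewrite /Q_succ {1}sgn nablaV_const D_const.
by congr (nabla _); exact: signK.
Qed.

Lemma Q_diag_X n : Q_diag q t nabla nablaV n ((-1) ^+ n) =
  (z / (z - 1) * z^-1 ^+ n * (-1) ^+ n) *: nabla (X n).
Proof.
have sgn : (-1) ^+ n = ((-1) ^+ n)%:A :> Lam.
  by rewrite -[RHS]/(in_alg Lam _) rmorph_sign.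
have nablaZ c f : nabla (c *: f) = c *: nabla f by exact: linearZ.
rewrite /Q_diag sgn nablaV_const scl_ratio_h mulr_algr !nablaZ !scalerA.
by apply: scaler_congr; rewrite /z; ring.
Qed.

(** All three expressions are multiples of nabla h_n[(1-qt)x]; only their scalars are compared. *)
Lemma Q_diag_Delta n : (0 < n)%N ->
  Q_diag q t nabla nablaV n ((-1) ^+ n)
    = (- z) ^ (1 - n%:Z) *: nabla (Delta (e 1) (h n))
  /\ (- z) ^ (1 - n%:Z) *: nabla (Delta (e 1) (h n)) = Delta (e n.-1) (e n).
Proof.
move=> n0; rewrite Q_diag_X (Delta_e_pred_e n0) (Delta_e1_h n0).
have nablaZ c f : nabla (c *: f) = c *: nabla f by exact: linearZ.
have z0 : z != 0 by rewrite mulf_neq0.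
have z1 : z - 1 != 0 by rewrite -opprB oppr_eq0.
(* The integer exponent is -(n-1), and -1 is its own inverse. *)
have pz : (- z) ^ (1 - n%:Z) = (-1) ^+ n.-1 * z^-1 ^+ n.-1.
  case: n n0 => // m _; have -> : 1 - m.+1%:Z = - m%:Z by lia.
  by rewrite -invr_expz -exprnP -[in LHS]mulN1r exprMn invfM -exprVn invrN1 exprVn.
rewrite nablaZ scalerA pz; split; apply: scaler_congr; case: n n0 {pz} => // m _.
  by rewrite !exprS /=; field; rewrite z0 z1 qt1.
by rewrite !exprS /=; field; rewrite z0 z1 qt1.
Qed.

End Identities.

(** * Genericity of q and t in Q(q,t), and the conclusion *)

Lemma tofrac_1B_neq0 (m : multinom 2) :
  m != 0%MM -> 1 - tofrac (mpolyX rat m) != 0 :> Qqt.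
Proof.
move=> m0; rewrite -(rmorph1 (@tofrac (mpoly 2 rat))) -rmorphB tofrac_eq0.
apply/eqP => /(congr1 (mpoly.mcoeff 0%MM)).
rewrite mpoly.mcoeffB mpoly.mcoeff1 mcoeffX eqxx (negbTE m0) mpoly.mcoeff0 subr0.
by move/eqP; rewrite oner_eq0.
Qed.

Lemma Qqt_generic :
  [/\ forall k, (0 < k)%N -> 1 - q ^+ k != 0,
      forall k, (0 < k)%N -> 1 - t ^+ k != 0,
      q != 0, t != 0 & 1 - q * t != 0].
Proof.
have mulm_neq0 i k : (0 < k)%N -> (U_(i) *+ k != 0 :> multinom 2)%MM.
  move=> k0; apply/eqP => /mnmP /(_ i).
  by rewrite mulmnE mnm1E eqxx mul1n mnm0E => e0; rewrite e0 in k0.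
have X0 (m : multinom 2) : tofrac (mpolyX rat m) != 0.
  rewrite tofrac_eq0; apply/eqP => /(congr1 (mpoly.mcoeff m)).
  by rewrite mcoeffX eqxx mpoly.mcoeff0 => /eqP; rewrite oner_eq0.
split; try exact: X0.
- move=> k k0; rewrite /q -rmorphXn /= mpolyXn; apply: tofrac_1B_neq0.
  exact: mulm_neq0.
- move=> k k0; rewrite /t -rmorphXn /= mpolyXn; apply: tofrac_1B_neq0.
  exact: mulm_neq0.
rewrite /q /t -rmorphM -mpolyXD; apply: tofrac_1B_neq0.
by rewrite mnmD_eq0 mnm1_eq0.
Qed.

Theorem theorem6p4
  (H : intpart -> Lam Qqt) (HH : is_modified_macdonald q t H)
  (nabla : {linear Lam Qqt -> Lam Qqt}) (nablaV : Lam Qqt -> Lam Qqt)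
  (Hnabla : diagonal_on H (fun mu => T q t mu) nabla)
  (HnablaK : cancel nabla nablaV) (HnablaVK : cancel nablaV nabla)
  (Delta : Lam Qqt -> {linear Lam Qqt -> Lam Qqt})
  (HDelta : forall f : Lam Qqt,
     diagonal_on H (fun mu => plethB q t f mu) (Delta f))
  (n : nat) (hn : (1 <= n)%N) :
  Q_succ q t nabla nablaV n ((-1) ^+ n) = nabla (e n)
  /\ Q_diag q t nabla nablaV n ((-1) ^+ n)
     = (- (q * t)) ^ (1 - n%:Z) *: nabla (Delta (e 1) (h n))
  /\ (- (q * t)) ^ (1 - n%:Z) *: nabla (Delta (e 1) (h n))
     = Delta (e n.-1) (e n).
Proof.
have [qo to q0 t0 qt1] := Qqt_generic.
split.
  exact: (Q_succ_e HH qo Hnabla HnablaK n).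
exact: (Q_diag_Delta pchar_Qqt HH qo to q0 t0 qt1 Hnabla HnablaK HDelta hn).
Qed.
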